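(* Let $A$ be a Green $\mathcal D$-biset functor. The assignment $\times:\mathcal P_A\times\mathcal P_A\to\mathcal P_A$ sending a pair of objects $(G,K)$ to $G\times K$ and a pair of morphisms $(\alpha,\beta)\in A(H\times G)\times A(L\times K)$ to $(\alpha\times L)\circ(G\times\beta)\in A(H\times L\times G\times K)$ is a functor if and only if $A$ is commutative. In particular, when $A$ is commutative, this functor $\times$ endows $\mathcal P_A$ with a structure of a symmetric monoidal category.
   Context: Throughout, $R$ is a commutative unital ring, all groups are finite, and $\mathcal D$ is a non-empty class of finite groups closed under subquotients (so also under isomorphism) and cartesian products. The category $R\mathcal D$ has the groups in $\mathcal D$ as objects, $\mathrm{Hom}_{R\mathcal D}(G,H)=RB(H,G)=R\otimes_{\mathbb Z}B(H,G)$, where $B(H,G)$ is the Grothendieck group of finite $(H,G)$-bisets, and composition is induced by $V\circ U=V\times_G U$. A $\mathcal D$-biset functor is an $R$-linear functor $R\mathcal D\to R\text{-Mod}$. For an injective homomorphism $K\to G$, $\mathrm{Res}^G_K$ is the $(K,G)$-biset $G$ and $\mathrm{Ind}_K^G$ the $(G,K)$-biset $G$; for a surjective homomorphism $G\to Q$, $\mathrm{Inf}_Q^G$ is the $(G,Q)$-biset $Q$ and $\mathrm{Def}^G_Q$ the $(Q,G)$-biset $Q$; $\mathrm{Iso}$ denotes the biset of a group isomorphism. Products of morphisms of $R\mathcal D$ are induced by cartesian products of bisets. $\Delta(G)\le G\times G$ is the diagonal. A Green $\mathcal D$-biset functor is a $\mathcal D$-biset functor $A$ with $R$-bilinear products $A(G)\times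 A(H)\to A(G\times H)$, $(a,b)\mapsto a\times b$, and an identity element $\varepsilon\in A(1)$, associative and unital up to canonical group isomorphisms, with $A(\varphi\times\psi)(a\times b)=A(\varphi)(a)\times A(\psi)(b)$ for morphisms $\varphi,\psi$ of $R\mathcal D$. $A$ is commutative if $a\times b=A(\mathrm{Iso}_{H\times G}^{G\times H})(b\times a)$ for all $G,H\in\mathcal D$, $a\in A(G)$, $b\in A(H)$ (iso switching components). The category $\mathcal P_A$ has the groups in $\mathcal D$ as objects and $\mathrm{Hom}_{\mathcal P_A}(G,H)=A(H\times G)$; the composite of $\beta\in A(H\times G)$ and $\alpha\in A(G\times K)$ is $\beta\circ\alpha=A(H\times\overleftarrow{G}\times K)(\beta\times\alpha)$, where $\overleftarrow{G}=\mathrm{Def}^{\Delta(G)}_1\circ\mathrm{Res}^{G\times G}_{\Delta(G)}$ is a $(1,G\times G)$-biset; the identity of $G$ is $A(\mathrm{Ind}_{\Delta(G)}^{G\times G}\circ\mathrm{Inf}_1^{\Delta(G)})(\varepsilon)$. For $\alpha\in A(H\times G)$ and $L\in\mathcal D$: $\alpha\times L=A(\mathrm{Ind}_{H\times G\times L}^{H\times L\times G\times L}\mathrm{Inf}_{H\times G}^{H\times G\times L})(\alpha)\in A(H\times L\times G\times L)$, a morphism $G\times L\to H\times L$, with embedding $(h,g,l)\mapsto(h,l,g,l)$ and surjection $(h,g,l)\mapsto(h,g)$; for $\beta\in A(L\times K)$ and $G\in\mathcal D$: $G\times\beta=A(\mathrm{Ind}_{G\times L\times K}^{G\times L\times G\times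 K}\mathrm{Inf}_{L\times K}^{G\times L\times K})(\beta)\in A(G\times L\times G\times K)$, a morphism $G\times K\to G\times L$, with embedding $(g,l,k)\mapsto(g,l,g,k)$ and surjection $(g,l,k)\mapsto(l,k)$. *)

(* Defs.v *)
(* The axioms of boolp make the equivalence relations below boolean, so that
   {eq_quot _} applies. *)
From HB Require Import structures.
From mathcomp Require Import all_boot all_fingroup all_algebra.
From mathcomp Require Import boolp.

Set Implicit Arguments.
Unset Strict Implicit.
Unset Printing Implicit Defensive.

Import GRing.Theory.
Local Open Scope quotient_scope.

Definition unit_mul (_ _ : unit) : unit := tt.
Definition unit_inv (_ : unit) : unit := tt.
Fact unit_mulA : associative unit_mul. Proof. by []. Qed.
Fact unit_mul1 : left_id tt unit_mul. Proof. by case. Qed.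
Fact unit_mulV : left_inverse tt unit_inv unit_mul. Proof. by []. Qed.
HB.instance Definition _ := Finite_isGroup.Build unit unit_mulA unit_mul1 unit_mulV.

Record group_class := GroupClass {
  gc_mem :> finGroupType -> Prop;
  gc_nonempty : exists G, gc_mem G;
  gc_subquotient : forall (G Q : finGroupType) (K N : {group G}),
    gc_mem G -> (N <| K)%g -> ([set: Q] \isog K / N)%g -> gc_mem Q;
  gc_prod : forall G H : finGroupType,
    gc_mem G -> gc_mem H -> gc_mem (G * H)%type
}.

Lemma gc_sub (D : group_class) (G Q : finGroupType) (K : {group G}) :
  D G -> ([set: Q] \isog K)%g -> D Q.
Proof.
move=> DG iQK; apply: (gc_subquotient DG (normal1 K)).
exact: isog_trans iQK (quotient1_isog K).
Qed.

Lemma gc_unit (D : group_class) : D unit.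
Proof.
have [G DG] := gc_nonempty D; apply: (gc_sub (K := 1%G) DG).
apply: trivial_isog => //.
by apply/setP => -[]; rewrite !inE eqxx.
Qed.

Lemma gc_subg (D : group_class) (G : finGroupType) (K : {group G}) :
  D G -> D (subg_of K).
Proof.
move=> DG; apply: (gc_sub (K := K) DG).
by rewrite isog_sym; exact: isog_subg.
Qed.

Record obj (D : group_class) := Obj { obj_group :> finGroupType; objP : D obj_group }.

Section Objects.
Variable D : group_class.
Implicit Types G H K L : obj D.

Definition objX G H : obj D := Obj (gc_prod (objP G) (objP H)).
Definition obj1 : obj D := Obj (gc_unit D).

Definition diag_set (G : finGroupType) : {set G * G} := [set p | p.1 == p.2].

Fact diag_group_set (G : finGroupType) : group_set (diag_set G).
Proof.
apply/group_setP; split=> [|x y]; rewrite !inE //=.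
by move=> /eqP -> /eqP ->.
Qed.
Canonical diag_group (G : finGroupType) := Group (diag_group_set G).

Definition objDelta G : obj D := Obj (gc_subg (diag_group G) (objP (objX G G))).

End Objects.

Notation "G ** H" := (objX G H) (at level 40, left associativity).

Record biset_on (H G : finGroupType) (U : Type) := BisetOn {
  bon_l : H -> U -> U;
  bon_r : U -> G -> U;
  bon_l1 : forall u, bon_l 1%g u = u;
  bon_lM : forall h k u, bon_l (h * k)%g u = bon_l h (bon_l k u);
  bon_r1 : forall u, bon_r u 1%g = u;
  bon_rM : forall u g k, bon_r u (g * k)%g = bon_r (bon_r u g) k;
  bon_lr : forall h u g, bon_l h (bon_r u g) = bon_r (bon_l h u) g
}.

Record biset (H G : finGroupType) := Biset {
  bset :> finType;
  bstr : biset_on H G bset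
}.

Definition lact H G (U : biset H G) : H -> U -> U := bon_l (bstr U).
Definition ract H G (U : biset H G) : U -> G -> U := bon_r (bstr U).
Arguments lact {H G U} : simpl never.
Arguments ract {H G U} : simpl never.

Section BisetTheory.
Variables H G : finGroupType.
Implicit Types U V W : biset H G.

Lemma lact1 U u : lact 1%g u = u :> U. Proof. exact: bon_l1. Qed.
Lemma lactM U h k u : lact (h * k)%g u = lact h (lact k u) :> U.
Proof. exact: bon_lM. Qed.
Lemma ract1 U u : ract u 1%g = u :> U. Proof. exact: bon_r1. Qed.
Lemma ractM U u g k : ract u (g * k)%g = ract (ract u g) k :> U.
Proof. exact: bon_rM. Qed.
Lemma lract U h u g : lact h (ract u g) = ract (lact h u) g :> U.
Proof. exact: bon_lr. Qed.

Definition biset_iso U V : Prop := exists f : U -> V,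
  [/\ bijective f, forall h u, f (lact h u) = lact h (f u)
    & forall u g, f (ract u g) = ract (f u) g].

Lemma biset_iso_refl U : biset_iso U U.
Proof. by exists id; split=> //; exists id. Qed.

Lemma biset_iso_sym U V : biset_iso U V -> biset_iso V U.
Proof.
case=> f [[g fK gK] fl fr]; exists g; split; first by exists f.
- by move=> h v; apply: (can_inj fK); rewrite fl !gK.
- by move=> v k; apply: (can_inj fK); rewrite fr !gK.
Qed.

Lemma biset_iso_trans U V W : biset_iso U V -> biset_iso V W -> biset_iso U W.
Proof.
case=> f [bf fl fr] [g [bg gl gr]]; exists (g \o f).
by split=> [|h u|u k] /=; [exact: bij_comp | rewrite fl gl | rewrite fr gr].
Qed.

Lemma biset_iso_inj_surj U V (f : U -> V) :
    injective f -> (forall v, exists u, f u = v) ->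
    (forall h u, f (lact h u) = lact h (f u)) ->
    (forall u g, f (ract u g) = ract (f u) g) ->
  biset_iso U V.
Proof.
move=> fI fS fl fr; exists f; split=> //.
have fS' v : exists u, f u == v by have [u <-] := fS v; exists u.
exists (fun v => xchoose (fS' v)) => [u|v]; last exact: (eqP (xchooseP (fS' v))).
exact/fI/(eqP (xchooseP (fS' (f u)))).
Qed.

Definition bempty : biset H G.
Proof.
by exists void; exists (fun _ u => u) (fun u _ => u).
Defined.

Definition sum_l U V (h : H) (w : U + V) : U + V :=
  match w with inl u => inl (lact h u) | inr v => inr (lact h v) end.
Definition sum_r U V (w : U + V) (g : G) : U + V :=
  match w with inl u => inl (ract u g) | inr v => inr (ract v g) end.

Definition bsum U V : biset H G.
Proof.
exists (U + V)%type; exists (@sum_l U V) (@sum_r U V).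
- by case=> u /=; rewrite lact1.
- by move=> h k [] u /=; rewrite lactM.
- by case=> u /=; rewrite ract1.
- by move=> [] u g k /=; rewrite ractM.
- by move=> h [] u g /=; rewrite lract.
Defined.

Lemma bsum_iso U U' V V' :
  biset_iso U U' -> biset_iso V V' -> biset_iso (bsum U V) (bsum U' V').
Proof.
case=> f [[f' fK f'K] fl fr] [g [[g' gK g'K] gl gr]].
exists (fun w : bsum U V =>
  match w with inl u => inl (f u) | inr v => inr (g v) end : bsum U' V').
split.
- exists (fun w => match w with inl u => inl (f' u) | inr v => inr (g' v) end).
  + by case=> u; rewrite ?fK ?gK.
  + by case=> u; rewrite ?f'K ?g'K.
- by move=> h [] u; rewrite /lact /= ?fl ?gl.
- by move=> [] u k; rewrite /ract /= ?fr ?gr.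
Qed.

Lemma bsumC U V : biset_iso (bsum U V) (bsum V U).
Proof.
pose s A B (w : A + B) : B + A := match w with inl u => inr u | inr v => inl v end.
exists (s U V); split; last 2 first.
- by move=> h [].
- by move=> [].
by exists (s V U); case.
Qed.

Lemma bsumA U V W : biset_iso (bsum U (bsum V W)) (bsum (bsum U V) W).
Proof.
exists (fun w : bsum U (bsum V W) => match w with
  | inl u => inl (inl u) | inr (inl v) => inl (inr v) | inr (inr x) => inr x
  end : bsum (bsum U V) W).
split.
- exists (fun w => match w with
    | inl (inl u) => inl u | inl (inr v) => inr (inl v) | inr x => inr (inr x) end).
  + by case=> [|[]].
  + by case=> [[]|].
- by move=> h [|[]].
- by move=> [|[]].
Qed.

Lemma bsum0 U : biset_iso (bsum bempty U) U.
Proof.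
exists (fun w : bsum bempty U => match w with
  | inl v => match v with end | inr u => u end).
split.
- by exists inr => // -[[]|].
- by move=> h [[]|].
- by move=> [[]|].
Qed.

(* Bisets with underlying set 'I_n: up to isomorphism these are all the finite
   bisets, and unlike [biset H G] they form a small type. *)
Definition sbiset : Type := {n : nat & biset_on H G 'I_n}.
Definition of_sbiset (U : sbiset) : biset H G := Biset (projT2 U).

Definition skel U : sbiset.
Proof.
exists #|U|; exists (fun h i => enum_rank (lact h (enum_val i)))
  (fun i g => enum_rank (ract (enum_val i) g)).
- by move=> u; rewrite lact1 enum_valK.
- by move=> h k u; rewrite enum_rankK lactM.
- by move=> u; rewrite ract1 enum_valK.
- by move=> h k u; rewrite enum_rankK ractM.
- by move=> h u g; rewrite !enum_rankK lract.
Defined.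

Lemma skelP U : biset_iso (of_sbiset (skel U)) U.
Proof.
exists (fun i : of_sbiset (skel U) => enum_val i); split.
- by exists enum_rank; [exact: enum_valK | exact: enum_rankK].
- by move=> h u; rewrite [in LHS]/lact /= enum_rankK.
- by move=> h u; rewrite [in LHS]/ract /= enum_rankK.
Qed.

Definition siso (U V : {classic sbiset}) : bool :=
  `[< biset_iso (of_sbiset U) (of_sbiset V) >].

Fact siso_refl : reflexive siso.
Proof. by move=> U; apply/asboolP/biset_iso_refl. Qed.
Fact siso_sym : symmetric siso.
Proof. by move=> U V; apply/asboolP/asboolP; apply: biset_iso_sym. Qed.
Fact siso_trans : transitive siso.
Proof.
by move=> V U W /asboolP UV /asboolP VW; apply/asboolP/biset_iso_trans/VW.
Qed.

Canonical siso_equiv := EquivRel siso siso_refl siso_sym siso_trans.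

Definition biset_class : Type := {eq_quot siso_equiv}.
HB.instance Definition _ := Choice.on biset_class.
HB.instance Definition _ := EqQuotient.on biset_class.

Definition bclass U : biset_class := \pi_({eq_quot siso_equiv}) (skel U).
Definition brepr (x : biset_class) : biset H G := of_sbiset (generic_quotient.repr x).

Lemma bclassP U V : bclass U = bclass V <-> biset_iso U V.
Proof.
split=> [/eqmodP/asboolP UV|UV].
  exact: biset_iso_trans (biset_iso_sym (skelP U)) (biset_iso_trans UV (skelP V)).
apply/eqmodP/asboolP; apply: biset_iso_trans (skelP U) _.
exact: biset_iso_trans UV (biset_iso_sym (skelP V)).
Qed.

Lemma breprK x : bclass (brepr x) = x.
Proof.
rewrite -[RHS]reprK; apply/eqmodP/asboolP; exact: skelP.
Qed.

Lemma brepr_iso U : biset_iso (brepr (bclass U)) U.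
Proof. by apply/bclassP; rewrite breprK. Qed.

Definition bclass_add x y := bclass (bsum (brepr x) (brepr y)).

Lemma bclass_addE U V : bclass_add (bclass U) (bclass V) = bclass (bsum U V).
Proof. by apply/bclassP/bsum_iso; exact: brepr_iso. Qed.

Fact bclass_addA : associative bclass_add.
Proof.
move=> x y z; rewrite -[x]breprK -[y]breprK -[z]breprK !bclass_addE.
exact/bclassP/bsumA.
Qed.
Fact bclass_addC : commutative bclass_add.
Proof. by move=> x y; apply/bclassP/bsumC. Qed.
Fact bclass_add0 : left_id (bclass bempty) bclass_add.
Proof. by move=> x; rewrite -[x]breprK bclass_addE; apply/bclassP/bsum0. Qed.

HB.instance Definition _ := GRing.isNmodule.Build biset_class
  bclass_addA bclass_addC bclass_add0.

Lemma bclassD U V : (bclass (bsum U V) = bclass U + bclass V)%R.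
Proof. by rewrite -bclass_addE. Qed.

End BisetTheory.

Arguments bclass {H G}.

Definition bid (G : finGroupType) : biset G G.
Proof.
exists G; exists (fun g x : G => (g * x)%g) (fun x g : G => (x * g)%g) => *;
  by rewrite ?mul1g ?mulg1 ?mulgA.
Defined.

(* H with h . x . g = h x f(g): this is Ind for f injective, Def for f
   surjective and Iso for f bijective *)
Definition push_biset (G H : finGroupType) (f : {multiplicative G -> H}) :
  biset H G.
Proof.
exists H; exists (fun h x : H => (h * x)%g) (fun (x : H) (g : G) => (x * f g)%g).
- exact: mul1g.
- by move=> *; rewrite mulgA.
- by move=> x; rewrite -[f 1%g](mulgK (f 1%g)) -gmulfM mulg1 mulgV mulg1.
- by move=> *; rewrite gmulfM mulgA.
- by move=> *; rewrite mulgA.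
Defined.

(* H with g . x . h = f(g) x h: this is Res for f injective and Inf for f
   surjective *)
Definition pull_biset (G H : finGroupType) (f : {multiplicative G -> H}) :
  biset G H.
Proof.
exists H; exists (fun (g : G) (x : H) => (f g * x)%g) (fun x h : H => (x * h)%g).
- by move=> x; rewrite -[f 1%g](mulgK (f 1%g)) -gmulfM mulg1 mulgV mul1g.
- by move=> *; rewrite gmulfM mulgA.
- exact: mulg1.
- by move=> *; rewrite mulgA.
- by move=> *; rewrite mulgA.
Defined.

Definition Ind := push_biset.
Definition Def := push_biset.
Definition Iso := push_biset.
Definition Res := pull_biset.
Definition Inf := pull_biset.

Definition bprod (H L G K : finGroupType) (U : biset H G) (V : biset L K) :
  biset (H * L)%type (G * K)%type.
Proof.
exists (U * V)%type;
  exists (fun (h : H * L) (w : U * V) => (lact h.1 w.1, lact h.2 w.2))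
         (fun (w : U * V) (g : G * K) => (ract w.1 g.1, ract w.2 g.2)).
- by case=> u v; rewrite !lact1.
- by move=> h k [u v]; rewrite !lactM.
- by case=> u v; rewrite !ract1.
- by move=> [u v] h k; rewrite !ractM.
- by move=> h [u v] k; rewrite /= !lract.
Defined.

Section Comp.
Variables K H G : finGroupType.

Section Balanced.
Variables (V : biset K H) (U : biset H G).

Definition orb (p : V * U) : {set V * U} :=
  [set (ract p.1 h^-1%g, lact h p.2) | h in [set: H]].

(* V x_H U, the set of H-orbits on V x U *)
Definition comp_set := {S : {set V * U} | S \in [set orb p | p in setT]}.

Definition comp_pi (p : V * U) : comp_set :=
  exist _ (orb p) (imset_f orb (in_setT p)).

Definition comp_map (F : V * U -> V * U)
    (FO : forall p, F @: orb p = orb (F p)) (S : comp_set) : comp_set.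
Proof.
exists (F @: val S); case: S => S /= /imsetP[p _ ->].
by rewrite FO; apply: imset_f; rewrite inE.
Defined.

Lemma comp_piP (S : comp_set) : exists p, S = comp_pi p.
Proof.
by case: S => S PS; have /imsetP[p _ Sp] := PS; exists p; apply: val_inj.
Qed.

Lemma comp_mapE F FO p : @comp_map F FO (comp_pi p) = comp_pi (F p).
Proof. by apply: val_inj; rewrite /= FO. Qed.

Lemma comp_piE v h u : comp_pi (ract v h, u) = comp_pi (v, lact h u).
Proof.
apply: val_inj; apply/setP => q /=; apply/imsetP/imsetP => -[k _ ->] /=.
- by exists (k * h^-1)%g => //=; rewrite -ractM -lactM invMg invgK mulgKV.
- by exists (k * h)%g => //=; rewrite -ractM -lactM invMg mulKVg.
Qed.

Lemma orb_eq p q : orb p = orb q -> exists h, q = (ract p.1 h^-1%g, lact h p.2).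
Proof.
move=> Epq; have : q \in orb q.
  by apply/imsetP; exists 1%g => //; rewrite invg1 ract1 lact1; case: (q).
by rewrite -Epq => /imsetP[h _ ->]; exists h.
Qed.

Lemma comp_pi_eq p q : comp_pi p = comp_pi q ->
  exists h, q = (ract p.1 h^-1%g, lact h p.2).
Proof. by case=> /orb_eq. Qed.

Definition lcomp (k : K) (p : V * U) : V * U := (lact k p.1, p.2).
Definition rcomp (g : G) (p : V * U) : V * U := (p.1, ract p.2 g).

Lemma lcompO k p : lcomp k @: orb p = orb (lcomp k p).
Proof.
by rewrite /orb -imset_comp; apply: eq_imset => h; rewrite /= /lcomp /= lract.
Qed.
Lemma rcompO g p : rcomp g @: orb p = orb (rcomp g p).
Proof.
by rewrite /orb -imset_comp; apply: eq_imset => h; rewrite /= /rcomp /= lract.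
Qed.

Definition bcomp : biset K G.
Proof.
exists comp_set; exists (fun k => comp_map (lcompO k))
                        (fun S g => comp_map (rcompO g) S).
- move=> S; have [[v u] ->] := comp_piP S.
  by rewrite comp_mapE /lcomp lact1.
- move=> h k S; have [[v u] ->] := comp_piP S.
  by rewrite !comp_mapE /lcomp lactM.
- move=> S; have [[v u] ->] := comp_piP S.
  by rewrite comp_mapE /rcomp ract1.
- move=> S h k; have [[v u] ->] := comp_piP S.
  by rewrite !comp_mapE /rcomp ractM.
- by move=> h S k; have [[v u] ->] := comp_piP S; rewrite !comp_mapE.
Defined.

Lemma bcomp_lE k v u : lact k (comp_pi (v, u) : bcomp) = comp_pi (lact k v, u).
Proof. exact: comp_mapE. Qed.
Lemma bcomp_rE g v u : ract (comp_pi (v, u) : bcomp) g = comp_pi (v, ract u g).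
Proof. exact: comp_mapE. Qed.

Lemma bcomp_iso (W : biset K G) (f : V -> U -> W) :
    (forall v h u, f (ract v h) u = f v (lact h u)) ->
    (forall k v u, f (lact k v) u = lact k (f v u)) ->
    (forall v u g, f v (ract u g) = ract (f v u) g) ->
    (forall v u v' u', f v u = f v' u' ->
       exists h, v' = ract v h^-1%g /\ u' = lact h u) ->
    (forall w, exists v u, f v u = w) ->
  biset_iso bcomp W.
Proof.
move=> fb fl fr fI fS.
have ex (S : bcomp) : exists p, S == comp_pi p.
  by have [p ->] := comp_piP S; exists p.
pose F S := let p := xchoose (ex S) in f p.1 p.2.
have FE v u : F (comp_pi (v, u)) = f v u.
  rewrite /F; move: (xchooseP (ex (comp_pi (v, u)))) => /eqP/comp_pi_eq[h ->] /=.
  by rewrite fb -lactM mulVg lact1.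
apply: (@biset_iso_inj_surj _ _ _ _ F).
- move=> S T; have [[v u] ->] := comp_piP S; have [[v' u'] ->] := comp_piP T.
  rewrite !FE => /fI[h [-> ->]].
  by rewrite comp_piE -lactM mulVg lact1.
- by move=> w; have [v [u <-]] := fS w; exists (comp_pi (v, u)); rewrite FE.
- by move=> k S; have [[v u] ->] := comp_piP S; rewrite bcomp_lE !FE fl.
- by move=> S g; have [[v u] ->] := comp_piP S; rewrite bcomp_rE !FE fr.
Qed.

End Balanced.
End Comp.

Lemma bcomp_congr (K H G : finGroupType) (V V' : biset K H) (U U' : biset H G) :
  biset_iso V V' -> biset_iso U U' -> biset_iso (bcomp V U) (bcomp V' U').
Proof.
case=> f [[f' fK f'K] fl fr] [g [[g' gK g'K] gl gr]].
apply: (@bcomp_iso _ _ _ _ _ _ (fun v u => comp_pi (f v, g u) : bcomp V' U')).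
- by move=> v h u; rewrite fr gl comp_piE.
- by move=> k v u; rewrite fl bcomp_lE.
- by move=> v u k; rewrite gr bcomp_rE.
- move=> v u v' u' /comp_pi_eq[h /= [Ev Eu]]; exists h.
  by split; [apply: (can_inj fK) | apply: (can_inj gK)]; rewrite ?fr ?gl.
- move=> S; have [[v u] ->] := comp_piP S.
  by exists (f' v), (g' u); rewrite f'K g'K.
Qed.

Lemma bcomp_suml (K H G : finGroupType) (V V' : biset K H) (U : biset H G) :
  biset_iso (bcomp (bsum V V') U) (bsum (bcomp V U) (bcomp V' U)).
Proof.
pose f (w : bsum V V') u : bsum (bcomp V U) (bcomp V' U) := match w with
  | inl v => inl (comp_pi (v, u)) | inr v => inr (comp_pi (v, u)) end.
apply: (@bcomp_iso _ _ _ _ _ _ f).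
- by move=> [] v h u; rewrite /f /ract /= -/(ract v h) comp_piE.
- by move=> k [] v u; rewrite [in RHS]/lact /= bcomp_lE.
- by move=> [] v u g; rewrite [in RHS]/ract /= bcomp_rE.
- move=> [] v u [] v' u' //= [] /orb_eq[h /= [-> ->]];
    by exists h.
- by move=> [] S; have [[v u] ->] := comp_piP S;
    [exists (inl v), u | exists (inr v), u].
Qed.

Lemma bcomp_sumr (K H G : finGroupType) (V : biset K H) (U U' : biset H G) :
  biset_iso (bcomp V (bsum U U')) (bsum (bcomp V U) (bcomp V U')).
Proof.
pose f v (w : bsum U U') : bsum (bcomp V U) (bcomp V U') := match w with
  | inl u => inl (comp_pi (v, u)) | inr u => inr (comp_pi (v, u)) end.
apply: (@bcomp_iso _ _ _ _ _ _ f).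
- by move=> v h [] u; rewrite /f /lact /= -/(lact h u) comp_piE.
- by move=> k v [] u; rewrite [in RHS]/lact /= bcomp_lE.
- by move=> v [] u g; rewrite [in RHS]/ract /= bcomp_rE.
- move=> v [] u v' [] u' //= [] /orb_eq[h /= [-> ->]];
    by exists h.
- by move=> [] S; have [[v u] ->] := comp_piP S;
    [exists v, (inl u) | exists v, (inr u)].
Qed.

Section ProdTheory.
Variables H L G K : finGroupType.

Lemma bprod_congr (U U' : biset H G) (V V' : biset L K) :
  biset_iso U U' -> biset_iso V V' -> biset_iso (bprod U V) (bprod U' V').
Proof.
case=> f [[f' fK f'K] fl fr] [g [[g' gK g'K] gl gr]].
exists (fun w : bprod U V => (f w.1, g w.2) : bprod U' V'); split.
- exists (fun w => (f' w.1, g' w.2)).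
  + by case=> u v /=; rewrite fK gK.
  + by case=> u v /=; rewrite f'K g'K.
- by move=> h u; rewrite /lact /= -/(lact _ _) fl gl.
- by move=> u h; rewrite /ract /= -/(ract _ _) fr gr.
Qed.

Lemma bprod_suml (U U' : biset H G) (V : biset L K) :
  biset_iso (bprod (bsum U U') V) (bsum (bprod U V) (bprod U' V)).
Proof.
exists (fun w : bprod (bsum U U') V => match w.1 with
  | inl u => inl (u, w.2) | inr u => inr (u, w.2) end
  : bsum (bprod U V) (bprod U' V)).
split.
- exists (fun w => match w with
    | inl p => (inl p.1, p.2) | inr p => (inr p.1, p.2) end).
  + by case=> -[].
  + by case=> -[].
- by move=> h [[]].
- by move=> [[]].
Qed.

Lemma bprod_sumr (U : biset H G) (V V' : biset L K) :
  biset_iso (bprod U (bsum V V')) (bsum (bprod U V) (bprod U V')).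
Proof.
exists (fun w : bprod U (bsum V V') => match w.2 with
  | inl v => inl (w.1, v) | inr v => inr (w.1, v) end
  : bsum (bprod U V) (bprod U V')).
split.
- exists (fun w => match w with
    | inl p => (p.1, inl p.2) | inr p => (p.1, inr p.2) end).
  + by case=> u [].
  + by case=> -[].
- by move=> h [u []].
- by move=> [u []].
Qed.

End ProdTheory.

Local Open Scope ring_scope.

Section Groth.
Variable M : nmodType.
Implicit Types x y z : M * M.

(* the pair (a, b) stands for the formal difference a - b *)
Definition groth_rel x y : bool :=
  `[< exists e, x.1 + y.2 + e = y.1 + x.2 + e >].

Fact groth_refl : reflexive groth_rel.
Proof. by move=> x; apply/asboolP; exists 0. Qed.
Fact groth_sym : symmetric groth_rel.
Proof. by move=> x y; apply/asboolP/asboolP => -[e E]; exists e. Qed.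
Fact groth_trans : transitive groth_rel.
Proof.
move=> y x z /asboolP[e E] /asboolP[e' E']; apply/asboolP.
exists (y.1 + y.2 + e + e').
rewrite [LHS](AC (2*(2*1*1)) ((1*4*5)*(3*2*6)))%AC /= E E'.
by rewrite [LHS](AC (3*3) ((4*2)*(1*5*3*6)))%AC.
Qed.
Canonical groth_equiv := EquivRel groth_rel groth_refl groth_sym groth_trans.

Definition groth : Type := {eq_quot groth_equiv}.
HB.instance Definition _ := Choice.on groth.
HB.instance Definition _ := EqQuotient.on groth.

Definition gpi x : groth := \pi_({eq_quot groth_equiv}) x.
Definition grepr (a : groth) : M * M := generic_quotient.repr a.

Lemma greprK a : gpi (grepr a) = a. Proof. exact: reprK. Qed.

Lemma gpiP x y : gpi x = gpi y <-> exists e, x.1 + y.2 + e = y.1 + x.2 + e.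
Proof. by split=> [/eqmodP/asboolP|E]; last exact/eqmodP/asboolP. Qed.

Definition groth_add (a b : groth) : groth :=
  gpi ((grepr a).1 + (grepr b).1, (grepr a).2 + (grepr b).2).
Definition groth_opp (a : groth) : groth := gpi ((grepr a).2, (grepr a).1).

Lemma groth_addE x y : groth_add (gpi x) (gpi y) = gpi (x.1 + y.1, x.2 + y.2).
Proof.
have /gpiP[e E] := greprK (gpi x); have /gpiP[e' E'] := greprK (gpi y).
apply/gpiP; exists (e + e') => /=.
rewrite [LHS](AC (2*2*2) ((1*3*5)*(2*4*6)))%AC /= E E'.
by rewrite [LHS](AC (3*3) ((1*4)*(2*5)*(3*6)))%AC.
Qed.

Lemma groth_oppE x : groth_opp (gpi x) = gpi (x.2, x.1).
Proof.
have /gpiP[e E] := greprK (gpi x); apply/gpiP; exists e => /=.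
by rewrite [_ + x.1]addrC -E [_ + x.2]addrC.
Qed.

Fact groth_addA : associative groth_add.
Proof.
move=> a b c; rewrite -[a]greprK -[b]greprK -[c]greprK !groth_addE /=.
by rewrite !addrA.
Qed.
Fact groth_addC : commutative groth_add.
Proof.
by move=> a b; rewrite /groth_add; congr (gpi (_, _)); rewrite addrC.
Qed.
Fact groth_add0 : left_id (gpi (0, 0)) groth_add.
Proof.
move=> a; rewrite -[a]greprK groth_addE /= !add0r.
by case: (grepr a).
Qed.
Fact groth_addN : left_inverse (gpi (0, 0)) groth_opp groth_add.
Proof.
move=> a; rewrite -[a]greprK groth_oppE groth_addE; apply/gpiP.
by exists 0; rewrite /= !addr0 add0r addrC.
Qed.

HB.instance Definition _ := GRing.isZmodule.Build groth
  groth_addA groth_addC groth_add0 groth_addN.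

Definition gin (m : M) : groth := gpi (m, 0).

Lemma gpiD x y : gpi x + gpi y = gpi (x.1 + y.1, x.2 + y.2).
Proof. exact: groth_addE. Qed.

Lemma ginD m n : gin (m + n) = gin m + gin n.
Proof. by rewrite gpiD /= addr0. Qed.

Lemma gpiB x : gpi x = gin x.1 - gin x.2.
Proof.
rewrite [- _]groth_oppE gpiD /= addr0 add0r.
by case: x.
Qed.

End Groth.

Definition biadditive (M N P : nmodType) (f : M -> N -> P) : Prop :=
  (forall n, {morph f^~ n : m m' / m + m'}) /\
  (forall m, {morph f m : n n' / n + n'}).

(* (a - a')(b - b') = (ab + a'b') - (ab' + a'b); independent of the chosen
   representatives for f biadditive, by groth_ext_pi *)
Definition groth_ext (M N P : nmodType) (f : M -> N -> P)
    (a : groth M) (b : groth N) : groth P :=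
  let x := grepr a in let y := grepr b in
  gpi (f x.1 y.1 + f x.2 y.2, f x.1 y.2 + f x.2 y.1).

Section GrothExt.
Variables (M N P : nmodType) (f : M -> N -> P).
Hypothesis fD : biadditive f.
Let fDl m m' n : f (m + m') n = f m n + f m' n. Proof. exact: fD.1. Qed.
Let fDr m n n' : f m (n + n') = f m n + f m n'. Proof. exact: fD.2. Qed.

Lemma groth_ext_pi x y : groth_ext f (gpi x) (gpi y) =
  gpi (f x.1 y.1 + f x.2 y.2, f x.1 y.2 + f x.2 y.1).
Proof.
rewrite /groth_ext; set x' := grepr _; set y' := grepr _.
have /gpiP[e E] : gpi x' = gpi x by exact: greprK.
have /gpiP[e' E'] : gpi y' = gpi y by exact: greprK.
transitivity (gpi (f x.1 y'.1 + f x.2 y'.2, f x.1 y'.2 + f x.2 y'.1)).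
  apply/gpiP => /=; exists (f e y'.1 + f e y'.2).
  have E1 := congr1 (f^~ y'.1) E; have E2 := congr1 (f^~ y'.2) E.
  rewrite !fDl in E1 E2.
  rewrite [LHS](AC (2*2*2) ((1*4*5)*(3*2*6)))%AC /= E1 -E2.
  by rewrite [LHS](AC (3*3) ((1*5)*(4*2)*(3*6)))%AC.
apply/gpiP => /=; exists (f x.1 e' + f x.2 e').
have E1 := congr1 (f x.1) E'; have E2 := congr1 (f x.2) E'.
rewrite !fDr in E1 E2.
rewrite [LHS](AC (2*2*2) ((1*3*5)*(4*2*6)))%AC /= E1 -E2.
by rewrite [LHS](AC (3*3) ((1*5)*(2*4)*(3*6)))%AC.
Qed.

Lemma groth_ext_in m n : groth_ext f (gin m) (gin n) = gin (f m n).
Proof.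
have idem (p : P) : p + p = p -> gin p = 0.
  by move=> pp; apply: (addrI (gin p)); rewrite -ginD pp addr0.
rewrite groth_ext_pi gpiB /= !ginD.
have -> : gin (f 0 n) = 0 by apply: idem; rewrite -fDl addr0.
have -> : gin (f m 0) = 0 by apply: idem; rewrite -fDr addr0.
have -> : gin (f 0 0) = 0 by apply: idem; rewrite -fDl addr0.
by rewrite !addr0 subr0.
Qed.

Lemma groth_ext_biadd : biadditive (groth_ext f).
Proof.
split=> [c a b|c a b]; rewrite -[a]greprK -[b]greprK -[c]greprK.
  rewrite gpiD !groth_ext_pi gpiD /= !fDl.
  by congr (gpi (_, _)); rewrite addrACA.
rewrite gpiD !groth_ext_pi gpiD /= !fDr.
by congr (gpi (_, _)); rewrite addrACA.
Qed.

End GrothExt.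

Section Tensor.
Variables (R : comPzRingType) (M : zmodType).
Implicit Types s t : seq (R * M).

(* the congruence defining R (x)_Z M as a quotient of the monoid of formal
   sums of pairs (r, m) *)
Inductive tens_cong : seq (R * M) -> seq (R * M) -> Prop :=
| tens_refl s : tens_cong s s
| tens_sym s t : tens_cong s t -> tens_cong t s
| tens_trans s t u : tens_cong s t -> tens_cong t u -> tens_cong s u
| tens_cat s s' t t' :
    tens_cong s s' -> tens_cong t t' -> tens_cong (s ++ t) (s' ++ t')
| tens_catC s t : tens_cong (s ++ t) (t ++ s)
| tens_Dl r r' m : tens_cong [:: (r + r', m)] [:: (r, m); (r', m)]
| tens_Dr r m m' : tens_cong [:: (r, m + m')] [:: (r, m); (r, m')]
| tens_0 m : tens_cong [:: (0, m)] [::].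

Definition tens_rel s t : bool := `[< tens_cong s t >].
Fact tens_rel_refl : reflexive tens_rel.
Proof. by move=> s; apply/asboolP; apply: tens_refl. Qed.
Fact tens_rel_sym : symmetric tens_rel.
Proof. by move=> s t; apply/asboolP/asboolP; apply: tens_sym. Qed.
Fact tens_rel_trans : transitive tens_rel.
Proof.
by move=> t s u /asboolP st /asboolP tu; apply/asboolP; apply: tens_trans st tu.
Qed.
Canonical tens_equiv :=
  EquivRel tens_rel tens_rel_refl tens_rel_sym tens_rel_trans.

Definition tensor : Type := {eq_quot tens_equiv}.
HB.instance Definition _ := Choice.on tensor.
HB.instance Definition _ := EqQuotient.on tensor.

Definition tpi s : tensor := \pi_({eq_quot tens_equiv}) s.
Definition trepr (x : tensor) : seq (R * M) := generic_quotient.repr x.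

Lemma treprK x : tpi (trepr x) = x. Proof. exact: reprK. Qed.

Lemma tpiP s t : tpi s = tpi t <-> tens_cong s t.
Proof. by split=> [/eqmodP/asboolP|E]; last exact/eqmodP/asboolP. Qed.

Definition tscale_seq (a : R) s := [seq (a * p.1, p.2) | p <- s].

Lemma tscale_cong a s t :
  tens_cong s t -> tens_cong (tscale_seq a s) (tscale_seq a t).
Proof.
elim=> {s t} /=.
- by move=> s; apply: tens_refl.
- by move=> s t _; apply: tens_sym.
- by move=> s t u _ st _; apply: tens_trans st.
- by move=> s s' t t' _ ss' _ tt'; rewrite /tscale_seq !map_cat; apply: tens_cat.
- by move=> s t; rewrite /tscale_seq !map_cat; apply: tens_catC.
- by move=> r r' m; rewrite mulrDr; apply: tens_Dl.
- by move=> r m m'; apply: tens_Dr.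
- by move=> m; rewrite mulr0; apply: tens_0.
Qed.

Definition tadd (x y : tensor) : tensor := tpi (trepr x ++ trepr y).
Definition tscale (a : R) (x : tensor) : tensor := tpi (tscale_seq a (trepr x)).

Lemma taddE s t : tadd (tpi s) (tpi t) = tpi (s ++ t).
Proof. by apply/tpiP/tens_cat; apply/tpiP/treprK. Qed.
Lemma tscaleE a s : tscale a (tpi s) = tpi (tscale_seq a s).
Proof. by apply/tpiP/tscale_cong/tpiP/treprK. Qed.

Fact taddA : associative tadd.
Proof.
move=> x y z; rewrite -[x]treprK -[y]treprK -[z]treprK !taddE.
by rewrite catA.
Qed.
Fact taddC : commutative tadd.
Proof. by move=> x y; apply/tpiP/tens_catC. Qed.
Fact tadd0 : left_id (tpi [::]) tadd.
Proof. by move=> x; rewrite -[x]treprK taddE. Qed.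

Fact tscaleDl x a b : tscale (a + b) x = tadd (tscale a x) (tscale b x).
Proof.
rewrite -[x]treprK !tscaleE; elim: (trepr x) => [|[r m] s IHs].
  by rewrite taddE.
have E c : tpi (tscale_seq c ((r, m) :: s))
    = tadd (tpi [:: (c * r, m)]) (tpi (tscale_seq c s)) by rewrite taddE.
rewrite !E IHs /= mulrDl.
have -> : tpi [:: (a * r + b * r, m)]
    = tadd (tpi [:: (a * r, m)]) (tpi [:: (b * r, m)]).
  by rewrite taddE; apply/tpiP/tens_Dl.
rewrite -!taddA; congr tadd; rewrite !taddA; congr tadd; exact: taddC.
Qed.

Fact tscale0 x : tscale 0 x = tpi [::].
Proof.
rewrite -[x]treprK tscaleE; elim: (trepr x) => [|[r m] s IHs] //.
rewrite -[tscale_seq _ _]/([:: (0 * r, m)] ++ tscale_seq 0 s) -taddE IHs.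
by rewrite mul0r taddE; apply/tpiP/tens_0.
Qed.

Fact tscaleA a b x : tscale a (tscale b x) = tscale (a * b) x.
Proof.
rewrite -[x]treprK !tscaleE /tscale_seq -map_comp.
by congr tpi; apply: eq_map => p /=; rewrite mulrA.
Qed.
Fact tscale1 : left_id 1 tscale.
Proof.
move=> x; rewrite -[x]treprK tscaleE; congr tpi.
by apply: map_id_in => -[r m] _; rewrite mul1r.
Qed.
Fact tscaleDr : right_distributive tscale tadd.
Proof.
move=> a x y; rewrite -[x]treprK -[y]treprK !(tscaleE, taddE).
by rewrite /tscale_seq map_cat.
Qed.

Fact taddN : left_inverse (tpi [::]) (tscale (-1)) tadd.
Proof.
by move=> x; rewrite -[X in tadd _ X]tscale1 -tscaleDl addNr tscale0.
Qed.

HB.instance Definition _ := GRing.isZmodule.Build tensor taddA taddC tadd0 taddN.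
HB.instance Definition _ := GRing.Zmodule_isLmodule.Build R tensor
  tscaleA tscale1 tscaleDr tscaleDl.

Definition pure (r : R) (m : M) : tensor := tpi [:: (r, m)].

Lemma pureDl r r' m : pure (r + r') m = pure r m + pure r' m.
Proof. by rewrite [RHS]taddE; apply/tpiP/tens_Dl. Qed.
Lemma pureDr r m m' : pure r (m + m') = pure r m + pure r m'.
Proof. by rewrite [RHS]taddE; apply/tpiP/tens_Dr. Qed.
Lemma pureZ a r m : a *: pure r m = pure (a * r) m.
Proof. exact: tscaleE. Qed.
Lemma pure0 m : pure 0 m = 0.
Proof. by apply/tpiP/tens_0. Qed.

Lemma tpi_sum s : tpi s = \sum_(p <- s) pure p.1 p.2.
Proof.
elim: s => [|[r m] s IHs]; first by rewrite big_nil.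
by rewrite big_cons /= -IHs [RHS]taddE.
Qed.

Lemma sum_tens_cong (P : zmodType) (f : R -> M -> P) s t : biadditive f ->
  tens_cong s t -> \sum_(p <- s) f p.1 p.2 = \sum_(p <- t) f p.1 p.2.
Proof.
move=> [fDl fDr]; elim=> {s t} //=.
- by move=> s t u _ -> _ ->.
- by move=> s s' t t' _ ss' _ tt'; rewrite !big_cat /= ss' tt'.
- by move=> s t; rewrite !big_cat /= addrC.
- by move=> r r' m; rewrite !big_cons !big_nil /= fDl !addr0.
- by move=> r m m'; rewrite !big_cons !big_nil /= fDr !addr0.
- move=> m; rewrite big_cons !big_nil /= addr0.
  by apply: (addrI (f 0 m)); rewrite -fDl !addr0.
Qed.

End Tensor.

(* independent of the chosen representatives for f biadditive, by tens_ext_pi *)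
Definition tens_ext (R : comPzRingType) (M N P : zmodType) (f : M -> N -> P)
    (x : tensor R M) (y : tensor R N) : tensor R P :=
  \sum_(p <- trepr x) \sum_(q <- trepr y) pure (p.1 * q.1) (f p.2 q.2).

Section TensExt.
Variables (R : comPzRingType) (M N P : zmodType) (f : M -> N -> P).
Hypothesis fD : biadditive f.

Lemma tens_ext_pi (s : seq (R * M)) (t : seq (R * N)) : tens_ext f (tpi s) (tpi t)
  = \sum_(p <- s) \sum_(q <- t) pure (p.1 * q.1) (f p.2 q.2).
Proof.
have st (x y : seq (R * M)) (z : seq (R * N)) : tens_cong x y ->
    \sum_(p <- x) \sum_(q <- z) (pure (p.1 * q.1) (f p.2 q.2) : tensor R P)
  = \sum_(p <- y) \sum_(q <- z) (pure (p.1 * q.1) (f p.2 q.2) : tensor R P).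
  apply: (sum_tens_cong
    (f := fun (r : R) m => \sum_(q <- z) (pure (r * q.1) (f m q.2) : tensor R P))).
  by split=> [m r r'|r m m']; rewrite -big_split; apply: eq_bigr => q _ /=;
    rewrite ?mulrDl ?pureDl ?fD.1 ?pureDr.
rewrite /tens_ext (st _ s); last exact/tpiP/treprK.
apply: eq_bigr => p _.
apply: (sum_tens_cong (f := fun (r : R) n => pure (p.1 * r) (f p.2 n))).
  by split=> [m r r'|r m m'] /=; rewrite ?mulrDr ?pureDl ?fD.2 ?pureDr.
exact/tpiP/treprK.
Qed.

Lemma tens_ext_pure (r s : R) m n :
  tens_ext f (pure r m) (pure s n) = pure (r * s) (f m n).
Proof. by rewrite tens_ext_pi !big_seq1. Qed.

Lemma tens_extPl a (x x' : tensor R M) (y : tensor R N) :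
  tens_ext f (a *: x + x') y = a *: tens_ext f x y + tens_ext f x' y.
Proof.
rewrite -[x]treprK -[x']treprK -[y]treprK.
rewrite [_ *: tpi _]tscaleE [X in tens_ext _ X _]taddE !tens_ext_pi.
rewrite big_cat big_map; congr (_ + _); rewrite scaler_sumr.
apply: eq_bigr => p _; rewrite scaler_sumr; apply: eq_bigr => q _ /=.
by rewrite pureZ mulrA.
Qed.

Lemma tens_extPr a (x : tensor R M) (y y' : tensor R N) :
  tens_ext f x (a *: y + y') = a *: tens_ext f x y + tens_ext f x y'.
Proof.
rewrite -[x]treprK -[y']treprK -[y]treprK.
rewrite [_ *: tpi _]tscaleE [X in tens_ext _ _ X]taddE !tens_ext_pi.
rewrite scaler_sumr -big_split; apply: eq_bigr => p _ /=.
rewrite big_cat big_map; congr (_ + _); rewrite scaler_sumr.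
by apply: eq_bigr => q _ /=; rewrite pureZ mulrCA.
Qed.

End TensExt.

Section ClassOp.
Variables H G L K P Q : finGroupType.
Variable op : biset H G -> biset L K -> biset P Q.
Hypothesis op_congr : forall U U' V V',
  biset_iso U U' -> biset_iso V V' -> biset_iso (op U V) (op U' V').
Hypothesis op_suml : forall U U' V,
  biset_iso (op (bsum U U') V) (bsum (op U V) (op U' V)).
Hypothesis op_sumr : forall U V V',
  biset_iso (op U (bsum V V')) (bsum (op U V) (op U V')).

Definition class_op (x : biset_class H G) (y : biset_class L K) :
  biset_class P Q := bclass (op (brepr x) (brepr y)).

Lemma class_opE U V : class_op (bclass U) (bclass V) = bclass (op U V).
Proof. by apply/bclassP/op_congr; exact: brepr_iso. Qed.

Lemma class_op_biadd : biadditive class_op.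
Proof.
split=> [z x y|z x y]; rewrite -[x]breprK -[y]breprK -[z]breprK.
  by rewrite -bclassD !class_opE -bclassD; apply/bclassP.
by rewrite -bclassD !class_opE -bclassD; apply/bclassP.
Qed.

End ClassOp.

Definition burnside (H G : finGroupType) : zmodType := groth (biset_class H G).

Definition RB (R : comPzRingType) (H G : finGroupType) : lmodType R :=
  tensor R (burnside H G).

Section RBOps.
Variable R : comPzRingType.

Definition rb H G (U : biset H G) : RB R H G := pure 1 (gin (bclass U)).

Definition rb_op H G L K P Q (op : biset H G -> biset L K -> biset P Q) :
    RB R H G -> RB R L K -> RB R P Q :=
  tens_ext (groth_ext (class_op op)).

Definition rb_comp (K H G : finGroupType) : RB R K H -> RB R H G -> RB R K G :=
  rb_op (@bcomp K H G).

Definition rb_prod (H L G K : finGroupType) :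
    RB R H G -> RB R L K -> RB R (H * L)%type (G * K)%type :=
  rb_op (@bprod H L G K).

Lemma bcomp_biadd K H G : biadditive (class_op (@bcomp K H G)).
Proof.
apply: class_op_biadd.
- exact: bcomp_congr.
- exact: bcomp_suml.
- exact: bcomp_sumr.
Qed.

Lemma bprod_biadd H L G K : biadditive (class_op (@bprod H L G K)).
Proof.
apply: class_op_biadd.
- exact: bprod_congr.
- exact: bprod_suml.
- exact: bprod_sumr.
Qed.

Lemma rb_iso H G (U V : biset H G) : biset_iso U V -> rb U = rb V.
Proof. by rewrite /rb => /bclassP ->. Qed.

Lemma rb_compE K H G (V : biset K H) (U : biset H G) :
  rb_comp (rb V) (rb U) = rb (bcomp V U).
Proof.
rewrite /rb_comp /rb_op tens_ext_pure; last exact/groth_ext_biadd/bcomp_biadd.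
rewrite mulr1 groth_ext_in; last exact: bcomp_biadd.
by rewrite class_opE //; exact: bcomp_congr.
Qed.

Lemma rb_prodE H L G K (U : biset H G) (V : biset L K) :
  rb_prod (rb U) (rb V) = rb (bprod U V).
Proof.
rewrite /rb_prod /rb_op tens_ext_pure; last exact/groth_ext_biadd/bprod_biadd.
rewrite mulr1 groth_ext_in; last exact: bprod_biadd.
by rewrite class_opE //; exact: bprod_congr.
Qed.

Lemma rb_compPl K H G a (x x' : RB R K H) (y : RB R H G) :
  rb_comp (a *: x + x') y = a *: rb_comp x y + rb_comp x' y.
Proof. exact/tens_extPl/groth_ext_biadd/bcomp_biadd. Qed.

Lemma rb_compPr K H G a (x : RB R K H) (y y' : RB R H G) :
  rb_comp x (a *: y + y') = a *: rb_comp x y + rb_comp x y'.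
Proof. exact/tens_extPr/groth_ext_biadd/bcomp_biadd. Qed.

Lemma rb_prodPl H L G K a (x x' : RB R H G) (y : RB R L K) :
  rb_prod (a *: x + x') y = a *: rb_prod x y + rb_prod x' y.
Proof. exact/tens_extPl/groth_ext_biadd/bprod_biadd. Qed.

Lemma rb_prodPr H L G K a (x : RB R H G) (y y' : RB R L K) :
  rb_prod x (a *: y + y') = a *: rb_prod x y + rb_prod x y'.
Proof. exact/tens_extPr/groth_ext_biadd/bprod_biadd. Qed.

End RBOps.

Arguments rb R {H G} U.

Section Homs.
Variables G H K L : finGroupType.

Definition gassoc (p : G * H * K) : G * (H * K) := (p.1.1, (p.1.2, p.2)).
Fact gassocM : {morph gassoc : x y / (x * y)%g}. Proof. by []. Qed.
HB.instance Definition _ := isMultiplicative.Build _ _ gassoc gassocM.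

Definition gswap (p : G * H) : H * G := (p.2, p.1).
Fact gswapM : {morph gswap : x y / (x * y)%g}. Proof. by []. Qed.
HB.instance Definition _ := isMultiplicative.Build _ _ gswap gswapM.

Definition gfst (p : G * H) : G := p.1.
Fact gfstM : {morph gfst : x y / (x * y)%g}. Proof. by []. Qed.
HB.instance Definition _ := isMultiplicative.Build _ _ gfst gfstM.

Definition gsnd (p : G * H) : H := p.2.
Fact gsndM : {morph gsnd : x y / (x * y)%g}. Proof. by []. Qed.
HB.instance Definition _ := isMultiplicative.Build _ _ gsnd gsndM.

Definition gtriv (_ : G) : unit := tt.
Fact gtrivM : {morph gtriv : x y / (x * y)%g}. Proof. by []. Qed.
HB.instance Definition _ := isMultiplicative.Build _ _ gtriv gtrivM.

Definition gdiag (x : subg_of (diag_group G)) : G * G := sgval x.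
Fact gdiagM : {morph gdiag : x y / (x * y)%g}. Proof. by []. Qed.
HB.instance Definition _ := isMultiplicative.Build _ _ gdiag gdiagM.

Definition gmiddle (p : (H * G) * (G * K)) : H * ((G * G) * K) :=
  (p.1.1, ((p.1.2, p.2.1), p.2.2)).
Fact gmiddleM : {morph gmiddle : x y / (x * y)%g}. Proof. by []. Qed.
HB.instance Definition _ := isMultiplicative.Build _ _ gmiddle gmiddleM.

Definition gdrop (p : H * (unit * K)) : H * K := (p.1, p.2.2).
Fact gdropM : {morph gdrop : x y / (x * y)%g}. Proof. by []. Qed.
HB.instance Definition _ := isMultiplicative.Build _ _ gdrop gdropM.

Definition gdup_r (p : (H * G) * L) : (H * L) * (G * L) :=
  ((p.1.1, p.2), (p.1.2, p.2)).
Fact gdup_rM : {morph gdup_r : x y / (x * y)%g}. Proof. by []. Qed.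
HB.instance Definition _ := isMultiplicative.Build _ _ gdup_r gdup_rM.

Definition gdup_l (p : G * (L * K)) : (G * L) * (G * K) :=
  ((p.1, p.2.1), (p.1, p.2.2)).
Fact gdup_lM : {morph gdup_l : x y / (x * y)%g}. Proof. by []. Qed.
HB.instance Definition _ := isMultiplicative.Build _ _ gdup_l gdup_lM.

End Homs.

(* R-linear functors from RD to R-modules; a morphism G -> H of RD is an element
   of RB(H, G) *)
Record biset_functor (R : comPzRingType) (D : group_class) := BisetFunctor {
  bf_obj :> obj D -> lmodType R;
  bf_map : forall G H : obj D, RB R H G -> {linear bf_obj G -> bf_obj H};
  bf_map_linear : forall (G H : obj D) (r : R) (phi psi : RB R H G) a,
    bf_map (r *: phi + psi) a = r *: bf_map phi a + bf_map psi a;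
  bf_map_id : forall (G : obj D) a, bf_map (rb R (bid G)) a = a;
  bf_map_comp : forall (G H K : obj D) (psi : RB R K H) (phi : RB R H G) a,
    bf_map (rb_comp psi phi) a = bf_map psi (bf_map phi a)
}.
Arguments bf_map {R D} b {G H}.

Record green_functor (R : comPzRingType) (D : group_class) := GreenFunctor {
  gf :> biset_functor R D;
  gf_prod : forall G H : obj D, gf G -> gf H -> gf (G ** H);
  gf_one : gf (obj1 D);
  gf_prod_linearl : forall (G H : obj D) (r : R) (a a' : gf G) (b : gf H),
    gf_prod (r *: a + a') b = r *: gf_prod a b + gf_prod a' b;
  gf_prod_linearr : forall (G H : obj D) (r : R) (a : gf G) (b b' : gf H),
    gf_prod a (r *: b + b') = r *: gf_prod a b + gf_prod a b';
  gf_prodA : forall (G H K : obj D) (a : gf G) (b : gf H) (c : gf K),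
    bf_map gf (G := G ** H ** K) (H := G ** (H ** K))
      (rb R (Iso (@gassoc G H K))) (gf_prod (gf_prod a b) c)
    = gf_prod a (gf_prod b c);
  gf_prod1l : forall (G : obj D) (a : gf G),
    bf_map gf (G := obj1 D ** G) (rb R (Iso (@gsnd unit G))) (gf_prod gf_one a)
    = a;
  gf_prod1r : forall (G : obj D) (a : gf G),
    bf_map gf (G := G ** obj1 D) (rb R (Iso (@gfst G unit))) (gf_prod a gf_one)
    = a;
  gf_prod_map : forall (G H K L : obj D) (phi : RB R H G) (psi : RB R L K)
      (a : gf G) (b : gf K),
    bf_map gf (G := G ** K) (H := H ** L) (rb_prod phi psi) (gf_prod a b)
    = gf_prod (bf_map gf phi a) (bf_map gf psi b)
}.
Arguments gf_prod {R D} g {G H}.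

Definition green_commutative (R : comPzRingType) (D : group_class)
    (A : green_functor R D) : Prop :=
  forall (G H : obj D) (a : A G) (b : A H),
  gf_prod A a b =
  bf_map A (G := H ** G) (H := G ** H) (rb R (Iso (@gswap H G))) (gf_prod A b a).

(* the data of a category; the axioms are is_category *)
Record precategory := Precategory {
  ob :> Type;
  hom : ob -> ob -> Type;
  idm : forall x, hom x x;
  compm : forall x y z, hom y z -> hom x y -> hom x z
}.
Arguments hom {p}.
Arguments idm {p}.
Arguments compm {p x y z}.

Definition is_category (C : precategory) : Prop :=
  [/\ forall (x y : C) (f : hom x y), compm (idm y) f = f,
      forall (x y : C) (f : hom x y), compm f (idm x) = f
    & forall (x y z t : C) (h : hom z t) (g : hom y z) (f : hom x y),
        compm h (compm g f) = compm (compm h g) f].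

Definition prod_cat (C D : precategory) : precategory := {|
  ob := C * D;
  hom x y := (hom x.1 y.1 * hom x.2 y.2)%type;
  idm x := (idm x.1, idm x.2);
  compm x y z g f := (compm g.1 f.1, compm g.2 f.2)
|}.

(* the data of a functor; the axioms are is_functor *)
Record prefunctor (C D : precategory) := Prefunctor {
  fob :> C -> D;
  fmor : forall x y : C, hom x y -> hom (fob x) (fob y)
}.
Arguments fmor {C D} p {x y}.

Definition is_functor (C D : precategory) (F : prefunctor C D) : Prop :=
  (forall x : C, fmor F (idm x) = idm (F x)) /\
  (forall (x y z : C) (g : hom y z) (f : hom x y),
     fmor F (compm g f) = compm (fmor F g) (fmor F f)).

Definition is_iso (C : precategory) (x y : C) (f : hom x y) : Prop :=
  exists g : hom y x, compm g f = idm x /\ compm f g = idm y.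

Record symmetric_monoidal (C : precategory) (T : prefunctor (prod_cat C C) C) :=
SymmetricMonoidal {
  ten (x y : C) : C := T (x, y);
  tenm (x y x' y' : C) (f : hom x x') (g : hom y y') : hom (ten x y) (ten x' y')
    := fmor T (x := (x, y)) (y := (x', y')) (f, g);
  sm_category : is_category C;
  sm_functor : is_functor T;
  sm_unit : C;
  sm_assoc : forall x y z : C, hom (ten (ten x y) z) (ten x (ten y z));
  sm_left : forall x : C, hom (ten sm_unit x) x;
  sm_right : forall x : C, hom (ten x sm_unit) x;
  sm_braid : forall x y : C, hom (ten x y) (ten y x);
  sm_assoc_iso : forall x y z, is_iso (sm_assoc x y z);
  sm_left_iso : forall x, is_iso (sm_left x);
  sm_right_iso : forall x, is_iso (sm_right x);
  sm_assoc_nat : forall (x y z x' y' z' : C)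
      (f : hom x x') (g : hom y y') (h : hom z z'),
    compm (sm_assoc x' y' z') (tenm (tenm f g) h)
    = compm (tenm f (tenm g h)) (sm_assoc x y z);
  sm_left_nat : forall (x x' : C) (f : hom x x'),
    compm (sm_left x') (tenm (idm sm_unit) f) = compm f (sm_left x);
  sm_right_nat : forall (x x' : C) (f : hom x x'),
    compm (sm_right x') (tenm f (idm sm_unit)) = compm f (sm_right x);
  sm_braid_nat : forall (x y x' y' : C) (f : hom x x') (g : hom y y'),
    compm (sm_braid x' y') (tenm f g) = compm (tenm g f) (sm_braid x y);
  sm_triangle : forall x y : C,
    compm (tenm (idm x) (sm_left y)) (sm_assoc x sm_unit y)
    = tenm (sm_right x) (idm y);
  sm_pentagon : forall x y z t : C,
    compm (sm_assoc x y (ten z t)) (sm_assoc (ten x y) z t)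
    = compm (tenm (idm x) (sm_assoc y z t))
        (compm (sm_assoc x (ten y z) t) (tenm (sm_assoc x y z) (idm t)));
  sm_hexagon : forall x y z : C,
    compm (sm_assoc y z x) (compm (sm_braid x (ten y z)) (sm_assoc x y z))
    = compm (tenm (idm y) (sm_braid x z))
        (compm (sm_assoc y x z) (tenm (sm_braid x y) (idm z)));
  sm_symmetry : forall x y : C,
    compm (sm_braid y x) (sm_braid x y) = idm (ten x y);
  sm_braid_unit : forall x : C,
    compm (sm_left x) (sm_braid x sm_unit) = sm_right x
}.

Section PA.
Variables (R : comPzRingType) (D : group_class) (A : green_functor R D).
Implicit Types G H K L : obj D.

Definition larrow G : RB R (obj1 D) (G ** G) :=
  rb_comp (rb R (Def (@gtriv (objDelta G)))) (rb R (Res (@gdiag G))).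

Definition pa_id G : A (G ** G) :=
  bf_map A (G := obj1 D) (H := G ** G)
    (rb_comp (rb R (Ind (@gdiag G))) (rb R (Inf (@gtriv (objDelta G)))))
    (gf_one A).

(* H x larrow(G) x K, with the identity bisets of H and K. The two isomorphisms
   rebracket (H x G) x (G x K) and identify H x (1 x K) with H x K. *)
Definition larrow_mid H G K : RB R (H ** K) ((H ** G) ** (G ** K)) :=
  rb_comp (rb R (Iso (@gdrop H K)))
    (rb_comp (rb_prod (rb R (bid H)) (rb_prod (larrow G) (rb R (bid K))))
       (rb R (Iso (@gmiddle G H K)))).

Definition pa_comp K G H (beta : A (H ** G)) (alpha : A (G ** K)) : A (H ** K) :=
  bf_map A (larrow_mid H G K) (gf_prod A beta alpha).

(* a morphism G -> H of P_A is an element of A(H x G) *)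
Definition PA : precategory := {|
  ob := obj D;
  hom G H := A (H ** G);
  idm := pa_id;
  compm := pa_comp
|}.

(* alpha x L, for alpha : G -> H in P_A *)
Definition pa_prod_r G H (alpha : A (H ** G)) L : A ((H ** L) ** (G ** L)) :=
  bf_map A (G := H ** G) (H := (H ** L) ** (G ** L))
    (rb_comp (rb R (Ind (@gdup_r G H L))) (rb R (Inf (@gfst (H ** G) L)))) alpha.

(* G x beta, for beta : K -> L in P_A *)
Definition pa_prod_l G K L (beta : A (L ** K)) : A ((G ** L) ** (G ** K)) :=
  bf_map A (G := L ** K) (H := (G ** L) ** (G ** K))
    (rb_comp (rb R (Ind (@gdup_l G K L))) (rb R (Inf (@gsnd G (L ** K))))) beta.

Definition pa_times : prefunctor (prod_cat PA PA) PA :=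
  @Prefunctor (prod_cat PA PA) PA
    (fun x => x.1 ** x.2)
    (fun x y f => compm (p := PA)
       (pa_prod_r f.1 y.2) (pa_prod_l x.1 f.2)).

End PA.

(* Main.v *)
(* Every operation involved acts on A through a transitive biset (H x G)/L, which
   is determined by the relation L <= H x G, and wherever two of them are composed
   here the Mackey formula has a single term, so that bisets compose like
   relations. Identities in P_A thus reduce to identities between relations.
   In particular (alpha x L) o (G x beta) is alpha x beta with its four
   coordinates permuted, while (H x beta) o (alpha x K) is beta x alpha permuted,
   so that the interchange law is equivalent to commutativity. The coherence
   isomorphisms are images of group isomorphisms under a monoidal functor into
   P_A, so their axioms reduce to equalities of homomorphisms. *)
From HB Require Import structures.
From mathcomp Require Import all_boot all_fingroup all_algebra.
Require Import Defs.

Set Implicit Arguments.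
Unset Strict Implicit.
Unset Printing Implicit Defensive.

(** * Transitive bisets as relations *)

Section BisetRelation.
Implicit Types G H K L : finGroupType.

(* U is isomorphic to (H x G)/L, where L = {(h, g) | rho h g} is the stabilizer
   of u0 for (h, g) . u = h u g^-1. *)
Definition biset_rel H G (U : biset H G) (rho : H -> G -> Prop) : Prop :=
  exists u0 : U, (forall u, exists h g, u = lact h (ract u0 g)) /\
    (forall h g, lact h u0 = ract u0 g <-> rho h g).

(** A transitive biset is determined by the stabilizer of a point; the isomorphism sends [h u0 g] to
    [h v0 g]. *)
Lemma biset_rel_iso H G (U V : biset H G) rho :
  biset_rel U rho -> biset_rel V rho -> biset_iso U V.
Proof.
move=> [u0 [uT uS]] [v0 [vT vS]].
have key (X : biset H G) (x : X) h g h' g' :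
    lact h (ract x g) = lact h' (ract x g') <->
    lact (h'^-1 * h)%g x = ract x (g' * g^-1)%g.
  split=> E.
    have := congr1 (fun y => lact h'^-1%g (ract y g^-1%g)) E.
    rewrite -!lract -!ractM -!lactM mulgV ract1 => ->.
    by rewrite mulVg lact1.
  have := congr1 (fun y => lact h' (ract y g)) E.
  by rewrite -!lract -!ractM -!lactM mulKVg mulgKV.
have ex u : exists p : H * G, u == lact p.1 (ract u0 p.2).
  by have [h [g ->]] := uT u; exists (h, g).
(* An arbitrary expression of [u] is chosen; [fE] shows that any other one gives the same value. *)
pose f u := let p := xchoose (ex u) in lact p.1 (ract v0 p.2).
have fE h g : f (lact h (ract u0 g)) = lact h (ract v0 g).
  rewrite /f; case: (xchoose _) (xchooseP (ex (lact h (ract u0 g)))) => h' g' /=.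
  by move=> /eqP/esym/key/uS/vS/key.
apply: (biset_iso_inj_surj (f := f)).
- move=> u u'; have [h [g ->]] := uT u; have [h' [g' ->]] := uT u'.
  by rewrite !fE => /key/vS/uS/key.
- by move=> v; have [h [g ->]] := vT v; exists (lact h (ract u0 g)).
- by move=> k u; have [h [g ->]] := uT u; rewrite -lactM !fE lactM.
- by move=> u k; have [h [g ->]] := uT u; rewrite -lract -ractM !fE ractM lract.
Qed.

Lemma biset_rel_ext H G (U : biset H G) rho sigma :
  (forall h g, rho h g <-> sigma h g) -> biset_rel U rho -> biset_rel U sigma.
Proof.
by move=> E [u [uT uS]]; exists u; split=> // h g; rewrite -E; apply: uS.
Qed.

Lemma biset_rel_id G : biset_rel (bid G) (fun h g => h = g).
Proof.
exists (1%g : G); split=> [u|h g]; rewrite /lact /ract /=.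
  by exists u, 1%g; rewrite !mulg1.
by rewrite mulg1 mul1g.
Qed.

Lemma multiplicative1 G H (f : {multiplicative G -> H}) : f 1%g = 1%g.
Proof. by rewrite -[f 1%g](mulgK (f 1%g)) -gmulfM mulg1 mulgV. Qed.

Lemma biset_rel_push G H (f : {multiplicative G -> H}) :
  biset_rel (push_biset f) (fun h g => h = f g).
Proof.
exists (1%g : H); split=> [u|h g]; rewrite /lact /ract /=.
  by exists u, 1%g; rewrite multiplicative1 !mulg1.
by rewrite mulg1 mul1g.
Qed.

Lemma biset_rel_pull G H (f : {multiplicative G -> H}) :
  biset_rel (pull_biset f) (fun g h => f g = h).
Proof.
exists (1%g : H); split=> [u|h g]; rewrite /lact /ract /=.
  by exists 1%g, u; rewrite multiplicative1 !mul1g.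
by rewrite mulg1 mul1g.
Qed.

Lemma biset_rel_prod H G L K (U : biset H G) (V : biset L K) rho sigma :
    biset_rel U rho -> biset_rel V sigma ->
  biset_rel (bprod U V) (fun h g => rho h.1 g.1 /\ sigma h.2 g.2).
Proof.
move=> [u [uT uS]] [v [vT vS]]; exists (u, v); split=> [[x y]|[h l] [g k]] /=.
  have [h [g ->]] := uT x; have [l [k ->]] := vT y.
  by exists (h, l), (g, k).
rewrite /lact /ract /= -!/(lact _ _) -!/(ract _ _).
by rewrite -uS -vS; split=> [[-> ->]|[-> ->]].
Qed.

(* When the double coset condition fails, the composite is not transitive and
   Mackey's formula has several terms. *)
Lemma biset_rel_comp K H G (V : biset K H) (U : biset H G) rho sigma :
    biset_rel V rho -> biset_rel U sigma ->
    (forall h, exists h1 h2,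
       [/\ exists k, rho k h1, exists g, sigma h2 g & h = (h1 * h2)%g]) ->
  biset_rel (bcomp V U) (fun k g => exists h, rho k h /\ sigma h g).
Proof.
move=> [v0 [vT vS]] [u0 [uT uS]] cov.
exists (comp_pi (v0, u0)); split=> [S|k g].
  have [[v u] ->] := comp_piP S.
  have [k [h ->]] := vT v; have [h' [g ->]] := uT u.
  (* Up to the actions of [k] and [g], the balanced pair depends only on [h * h']. Its factor [h1]
     passes through [v0] and becomes [k1]; its factor [h2] passes through [u0] and becomes [g2]. *)
  have [h1 [h2 [[k1 /vS E1] [g2 /uS E2] E]]] := cov (h * h')%g.
  exists (k * k1)%g, (g2 * g)%g.
  rewrite bcomp_rE bcomp_lE lactM E1 ractM -E2 -[ract (lact h2 u0) g]lract.
  by rewrite [lact k (ract v0 h)]lract [lact k (ract v0 h1)]lract !comp_piE -!lactM E.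
rewrite bcomp_lE bcomp_rE; split=> [/comp_pi_eq[h /= [E1 E2]]|[h [/vS -> /uS <-]]].
  exists h; split; last by apply/uS; rewrite E2.
  by apply/vS; rewrite [in RHS]E1 -ractM mulVg ract1.
by rewrite comp_piE.
Qed.

End BisetRelation.

(** * Green biset functors *)

Section GreenRelation.
Variables (R : comPzRingType) (D : group_class) (A : green_functor R D).
Implicit Types G H K L : obj D.

(** The biset stays existential, so that only relations have to be tracked. *)
Definition act_rel G H (rho : H -> G -> Prop) (a : A G) (b : A H) : Prop :=
  exists2 U : biset H G, biset_rel U rho & b = bf_map A (rb R U) a.

(** How identities in [A] are proved below: obtain both sides from one element and compare the
    relations. *)
Lemma act_rel_fun G H (rho sigma : H -> G -> Prop) (a : A G) (b b' : A H) :
    act_rel rho a b -> act_rel sigma a b' ->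
    (forall h g, rho h g <-> sigma h g) -> b = b'.
Proof.
move=> [U Ur ->] [V Vs ->] E.
by rewrite (rb_iso R (biset_rel_iso (biset_rel_ext E Ur) Vs)).
Qed.

Lemma act_rel_ext G H (rho sigma : H -> G -> Prop) (a : A G) (b : A H) :
    (forall h g, rho h g <-> sigma h g) ->
  act_rel rho a b -> act_rel sigma a b.
Proof. by move=> E [U /(biset_rel_ext E) Us ->]; exists U. Qed.

Lemma act_rel_id G (a : A G) : act_rel (fun h g => h = g) a a.
Proof. by exists (bid G); [exact: biset_rel_id | rewrite bf_map_id]. Qed.

Lemma act_rel_push G H (f : {multiplicative G -> H}) (a : A G) :
  act_rel (fun h g => h = f g) a (bf_map A (rb R (Iso f)) a).
Proof. by exists (Iso f) => //; exact: biset_rel_push. Qed.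

Lemma act_rel_comp G H K (rho : K -> H -> Prop) (sigma : H -> G -> Prop)
    (a : A G) (b : A H) (c : A K) :
    act_rel sigma a b -> act_rel rho b c ->
    (forall h, exists h1 h2,
       [/\ exists k, rho k h1, exists g, sigma h2 g & h = (h1 * h2)%g]) ->
  act_rel (fun k g => exists h, rho k h /\ sigma h g) a c.
Proof.
move=> [U Us ->] [V Vr ->] cov; exists (bcomp V U); first exact: biset_rel_comp.
by rewrite -rb_compE bf_map_comp.
Qed.

Lemma act_rel11 G H (rho : H -> G -> Prop) (a : A G) (b : A H) :
  act_rel rho a b -> rho 1%g 1%g.
Proof. by case=> U [u [_ uS]] _; apply/uS; rewrite lact1 ract1. Qed.

(** When the inner relation reaches all of [H], the double coset condition holds by [h = 1 * h];
    [act_rel_compr] is the mirror image, with [h * 1]. *)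
Lemma act_rel_compl G H K (rho : K -> H -> Prop) (sigma : H -> G -> Prop)
    (a : A G) (b : A H) (c : A K) :
    act_rel sigma a b -> act_rel rho b c -> (forall h, exists g, sigma h g) ->
  act_rel (fun k g => exists h, rho k h /\ sigma h g) a c.
Proof.
move=> Rab Rbc tot; apply: (act_rel_comp Rab Rbc) => h.
exists 1%g, h; split=> //; last by rewrite mul1g.
by exists 1%g; apply: act_rel11 Rbc.
Qed.

Lemma act_rel_compr G H K (rho : K -> H -> Prop) (sigma : H -> G -> Prop)
    (a : A G) (b : A H) (c : A K) :
    act_rel sigma a b -> act_rel rho b c -> (forall h, exists k, rho k h) ->
  act_rel (fun k g => exists h, rho k h /\ sigma h g) a c.
Proof.
move=> Rab Rbc tot; apply: (act_rel_comp Rab Rbc) => h.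
exists h, 1%g; split=> //; last by rewrite mulg1.
by exists 1%g; apply: act_rel11 Rab.
Qed.

Lemma act_rel_prod G H K L (rho : H -> G -> Prop) (sigma : L -> K -> Prop)
    (a : A G) (b : A H) (c : A K) (d : A L) :
    act_rel rho a b -> act_rel sigma c d ->
  act_rel (G := G ** K) (H := H ** L) (fun h g => rho h.1 g.1 /\ sigma h.2 g.2)
    (gf_prod A a c) (gf_prod A b d).
Proof.
move=> [U Us ->] [V Vr ->]; exists (bprod U V); first exact: biset_rel_prod.
by rewrite -gf_prod_map -rb_prodE.
Qed.

(** For bijective [f], the biset [Res f] inverts [Iso f]. This reads the unit laws backwards, so
    that a product with the identity element comes from its other factor. *)
Lemma act_rel_inv G H (f : {multiplicative G -> H}) (a : A G) (b : A H) :
    bijective f -> bf_map A (rb R (Iso f)) a = b ->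
  act_rel (fun g h => f g = h) b a.
Proof.
move=> [g fK gK] <-; exists (Res f); first exact: biset_rel_pull.
rewrite -bf_map_comp rb_compE.
rewrite -[LHS]bf_map_id; congr (bf_map A _ _).
apply/rb_iso/(biset_rel_iso (biset_rel_id G)).
apply: biset_rel_ext (biset_rel_comp (biset_rel_pull f) (biset_rel_push f) _).
  move=> x y; split=> [[z [<- /(can_inj fK)]] //|->].
  by exists (f y).
move=> x; exists 1%g, x; split; last by rewrite mul1g.
  by exists 1%g; rewrite multiplicative1.
by exists (g x); rewrite gK.
Qed.

Lemma act_rel_assoc G H K (a : A G) (b : A H) (c : A K) :
  act_rel (G := G ** H ** K) (H := G ** (H ** K))
    (fun p q => p = (q.1.1, (q.1.2, q.2)))
    (gf_prod A (gf_prod A a b) c) (gf_prod A a (gf_prod A b c)).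
Proof.
rewrite -gf_prodA.
exact: (@act_rel_push (G ** H ** K) (G ** (H ** K)) (@gassoc G H K)).
Qed.

Lemma act_rel_unitl G (a : A G) :
  act_rel (G := G) (H := obj1 D ** G) (fun p g => p.2 = g)
    a (gf_prod A (gf_one A) a).
Proof.
apply: (@act_rel_inv (obj1 D ** G) G (@gsnd unit G)); last exact: gf_prod1l.
by exists (fun g => (tt, g)) => // -[[]].
Qed.

Lemma act_rel_unitr G (a : A G) :
  act_rel (G := G) (H := G ** obj1 D) (fun p g => p.1 = g)
    a (gf_prod A a (gf_one A)).
Proof.
apply: (@act_rel_inv (G ** obj1 D) G (@gfst G unit)); last exact: gf_prod1r.
by exists (fun g => (g, tt)) => // -[g []].
Qed.

Definition swap_rel G H (p : (G * H)%type) (q : (H * G)%type) : Prop :=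
  p.1 = q.2 /\ p.2 = q.1.

Lemma green_commutativeP : green_commutative A <->
  forall G H (a : A G) (b : A H),
    act_rel (G := H ** G) (H := G ** H) (@swap_rel G H)
      (gf_prod A b a) (gf_prod A a b).
Proof.
have swapP G H (c : A (H ** G)) : act_rel (G := H ** G) (H := G ** H)
    (@swap_rel G H) c (bf_map A (G := H ** G) (H := G ** H) (rb R (Iso (@gswap H G))) c).
  apply: act_rel_ext (@act_rel_push (H ** G) (G ** H) (@gswap H G) c).
  by move=> [g h] [h' g']; split=> [[-> ->]|[/= -> ->]].
split=> comm G H a b; first by rewrite [gf_prod A a b]comm; exact: swapP.
exact: act_rel_fun (comm _ _ a b) (swapP _ _ _) _.
Qed.

(** * Composition and products of morphisms in [P_A] *)

(** Restriction to the diagonal followed by deflation leaves the condition that the two middle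
    coordinates agree; the outer ones are copied. *)
Lemma larrow_mid_rel H G K : exists2 U : biset (H * K)%type ((H * G) * (G * K))%type,
  larrow_mid R H G K = rb R U &
  biset_rel U (fun p q => [/\ p.1 = q.1.1, q.1.2 = q.2.1 & p.2 = q.2.2]).
Proof.
rewrite /larrow_mid /larrow !(rb_compE, rb_prodE).
eexists; first by [].
have larrowP : biset_rel (bcomp (Def (@gtriv (objDelta G))) (Res (@gdiag G)))
    (fun _ p => p.1 = p.2).
  apply: biset_rel_ext (biset_rel_comp (biset_rel_push _) (biset_rel_pull _) _).
    move=> [] [x y]; split=> [[d [_]]|/= <-].
      by rewrite /gdiag; case: d => /= z; rewrite inE => /eqP zz E;
         move: zz; rewrite E.
    have xx : (x, x) \in diag_group G by rewrite inE.
    by exists (Subg xx).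
  move=> d; exists 1%g, d; split; last by rewrite mul1g.
    by exists tt.
  by exists (gdiag d).
apply: biset_rel_ext (biset_rel_comp (biset_rel_push _)
  (biset_rel_comp (biset_rel_prod (biset_rel_id H)
    (biset_rel_prod larrowP (biset_rel_id K))) (biset_rel_push _) _) _).
- move=> [h k] [[h' x] [y k']] /=; split.
    by case=> [[h1 [[] k1]] /= [[-> ->] [[h2 [[x2 y2] k2]] /=
         [[-> [-> ->]] [-> -> -> ->]]]]].
  case=> -> -> ->; exists (h', (tt, k')); split=> //.
  by exists (h', ((y, y), k')).
- move=> z; exists 1%g, z; split; last by rewrite mul1g.
    by exists 1%g; split=> //; split.
  by case: z => h [[x y] k]; exists ((h, x), (y, k)).
- move=> [h [[] k]]; exists 1%g, (h, (tt, k)); split; last by rewrite mul1g.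
    by exists 1%g.
  by exists ((h, 1%g), (1%g, k)), (h, ((1%g, 1%g), k)).
Qed.

Lemma pa_comp_rel G H K (beta : A (H ** G)) (alpha : A (G ** K)) :
  act_rel (G := (H ** G) ** (G ** K)) (H := H ** K)
    (fun p q => [/\ p.1 = q.1.1, q.1.2 = q.2.1 & p.2 = q.2.2])
    (gf_prod A beta alpha) (pa_comp beta alpha).
Proof.
have [U EU Ur] := larrow_mid_rel H G K.
by exists U => //; rewrite /pa_comp EU.
Qed.

(** Mackey's formula has a single term because [rho] reaches every value of the contracted
    coordinate and so can correct any mismatch between its two copies. *)
Lemma act_rel_pa_comp G H K (P Q : obj D) (rho : H * G -> P -> Prop)
    (sigma : G * K -> Q -> Prop) (b : A P) (a : A Q)
    (beta : A (H ** G)) (alpha : A (G ** K)) :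
    act_rel (H := H ** G) rho b beta -> act_rel (H := G ** K) sigma a alpha ->
    (forall g, exists h p, rho (h, g) p) ->
  act_rel (G := P ** Q) (H := H ** K)
    (fun x y => exists g, rho (x.1, g) y.1 /\ sigma (g, x.2) y.2)
    (gf_prod A b a) (pa_comp beta alpha).
Proof.
move=> Rb Ra cov.
apply: act_rel_ext (act_rel_comp (act_rel_prod Rb Ra) (pa_comp_rel _ _) _).
  move=> [h k] [p q] /=; split.
    by case=> [[[h1 g1] [g2 k2]] /= [[-> -> ->] [? ?]]]; exists g2.
  by case=> g [rp sq]; exists ((h, g), (g, k)).
move=> [[h g] [g' k]].
case: Ra => V [v [vT vS]] _.
have [h0 [p0 r0]] := cov (g'^-1 * g)%g.
have s1 : sigma (1%g, 1%g) 1%g by apply/vS; rewrite lact1 ract1.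
(* The left factor has equal middle coordinates, so it can be contracted; the right one carries the
   mismatch [g'^-1 * g], which [rho] attains. *)
exists ((h * h0^-1, g'), (g', k))%g, ((h0, g'^-1 * g), (1, 1))%g; split.
- by exists ((h * h0^-1), k)%g.
- by exists (p0, 1%g).
by congr (_, _, (_, _)); rewrite /= ?mulgKV ?mulKVg ?mulg1.
Qed.

(** The common shape of identities, of [alpha x L], of [G x beta] and of graphs. Induction relates
    every element of [K] to its image, which gives the double coset condition. *)
Lemma indinf_rel G H K (i : {multiplicative K -> H}) (p : {multiplicative K -> G})
    (a : A G) : (exists s, cancel s p) ->
  act_rel (fun h g => exists k, h = i k /\ p k = g) a
    (bf_map A (rb_comp (rb R (Ind i)) (rb R (Inf p))) a).
Proof.
move=> [s sK]; exists (bcomp (Ind i) (Inf p)); last by rewrite rb_compE.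
apply: biset_rel_comp; [exact: biset_rel_push | exact: biset_rel_pull |].
move=> k; exists k, 1%g; split; last by rewrite mulg1.
  by exists (i k).
by exists 1%g; rewrite multiplicative1.
Qed.

Lemma pa_prod_r_rel G H (alpha : A (H ** G)) L :
  act_rel (G := H ** G) (H := (H ** L) ** (G ** L))
    (fun p q => [/\ p.1.1 = q.1, p.2.1 = q.2 & p.1.2 = p.2.2])
    alpha (pa_prod_r alpha L).
Proof.
apply: act_rel_ext (@indinf_rel (H ** G) ((H ** L) ** (G ** L)) (H ** G ** L)
  (@gdup_r G H L) (@gfst (H ** G) L) alpha _); last by exists (fun x => (x, 1%g)).
move=> [[h l] [g l']] [h' g'] /=; split=> [[[[h1 g1] l1] [[-> -> -> ->] [-> ->]]] //|].
by case=> -> -> ->; exists (h', g', l').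
Qed.

Lemma pa_prod_l_rel G K L (beta : A (L ** K)) :
  act_rel (G := L ** K) (H := (G ** L) ** (G ** K))
    (fun p q => [/\ p.1.2 = q.1, p.2.2 = q.2 & p.1.1 = p.2.1])
    beta (pa_prod_l G beta).
Proof.
apply: act_rel_ext (@indinf_rel (L ** K) ((G ** L) ** (G ** K)) (G ** (L ** K))
  (@gdup_l G K L) (@gsnd G (L ** K)) beta _); last by exists (fun x => (1%g, x)).
move=> [[h l] [g l']] [h' g'] /=; split=> [[[g1 [h1 l1]] [[-> -> -> ->] [-> ->]]] //|].
by case=> -> -> ->; exists (g, (h', g')).
Qed.


(** Both sides contract [H] and [G] in a triple product, which associativity brings to the form
    [(gamma x beta) x alpha] on the left. *)
Lemma pa_compA G H K L (gamma : A (L ** H)) (beta : A (H ** G))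
    (alpha : A (G ** K)) :
  pa_comp gamma (pa_comp beta alpha) = pa_comp (pa_comp gamma beta) alpha.
Proof.
have tot (X Y : obj D) (g : Y) : exists h p, (h, g) = p :> (X * Y)%type.
  by exists 1%g, (1%g, g).
apply: (act_rel_fun
  (act_rel_compl (act_rel_assoc _ _ _)
    (act_rel_pa_comp (act_rel_id gamma)
      (act_rel_pa_comp (act_rel_id beta) (act_rel_id alpha) _) _) _)
  (act_rel_pa_comp
    (act_rel_pa_comp (act_rel_id gamma) (act_rel_id beta) _)
    (act_rel_id alpha) _)).
- exact: tot.
- exact: tot.
- by move=> [p [q r]]; exists (p, q, r).
- exact: tot.
- by move=> g; exists 1%g, ((1%g, 1%g), (1%g, g)), 1%g.
move=> [l k] [[p q] r] /=; split.
  case=> -[p' [q' r']] /= [[h [<- [g [<- <-]]]] [<- <- <-]].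
  by exists g; split=> //; exists h.
by case=> g [[h [<- <-]] <-]; exists ((l, h), ((h, g), (g, k))); split=> //;
  exists h; split=> //; exists g.
Qed.

(* The coordinates duplicated by pa_prod_r and pa_prod_l are contracted by the
   composition: only a permutation of those of [gf_prod A a b] remains. *)
Lemma act_rel_pa_times G H K L (P Q : obj D) (rho : H * G -> P -> Prop)
    (sigma : L * K -> Q -> Prop) (a : A P) (b : A Q)
    (alpha : A (H ** G)) (beta : A (L ** K)) :
    act_rel (H := H ** G) rho a alpha -> act_rel (H := L ** K) sigma b beta ->
  act_rel (G := P ** Q) (H := (H ** L) ** (G ** K))
    (fun x y => rho (x.1.1, x.2.1) y.1 /\ sigma (x.1.2, x.2.2) y.2)
    (gf_prod A a b) (pa_comp (pa_prod_r alpha L) (pa_prod_l G beta)).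
Proof.
move=> Ra Rb.
apply: act_rel_ext (act_rel_compr (act_rel_prod Ra Rb)
  (act_rel_pa_comp (pa_prod_r_rel alpha L) (pa_prod_l_rel G beta) _) _).
- move=> [[h l] [g k]] [p q] /=; split.
    by case=> [[[h1 g1] [l1 k1]] [[[g2 l2] /= [[-> <- ->] [<- -> ->]]]]].
  move=> rs; exists ((h, g), (l, k)); split=> //.
  by exists (g, l).
- by move=> [g l]; exists (1%g, l), (1%g, g).
- by move=> [[h g] [l k]]; exists ((h, l), (g, k)), (g, l).
Qed.

(** The coordinates are permuted as in [act_rel_pa_times], but composing in the other order
    multiplies [a] and [b] in the other order. The two lemmas thus differ exactly by a swap of
    factors. *)
Lemma act_rel_pa_times_rev G H K L (P Q : obj D) (rho : H * G -> P -> Prop)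
    (sigma : L * K -> Q -> Prop) (a : A P) (b : A Q)
    (alpha : A (H ** G)) (beta : A (L ** K)) :
    act_rel (H := H ** G) rho a alpha -> act_rel (H := L ** K) sigma b beta ->
  act_rel (G := Q ** P) (H := (H ** L) ** (G ** K))
    (fun x y => rho (x.1.1, x.2.1) y.2 /\ sigma (x.1.2, x.2.2) y.1)
    (gf_prod A b a) (pa_comp (pa_prod_l H beta) (pa_prod_r alpha K)).
Proof.
move=> Ra Rb.
apply: act_rel_ext (act_rel_compr (act_rel_prod Rb Ra)
  (act_rel_pa_comp (pa_prod_l_rel H beta) (pa_prod_r_rel alpha K) _) _).
- move=> [[h l] [g k]] [p q] /=; split.
    by case=> [[[l1 k1] [h1 g1]] [[[h2 k2] /= [[-> <- ->] [<- -> ->]]]]] [].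
  move=> [r s]; exists ((l, k), (h, g)); split=> //.
  by exists (h, k).
- by move=> [h k]; exists (h, 1%g), (1%g, k).
- by move=> [[l k] [h g]]; exists ((h, l), (g, k)), (h, k).
Qed.

(** Both sides start from [beta x alpha]; on the right the intermediate coordinate in [L] is forced
    to equal the outer ones. *)
Lemma pa_prod_r_comp G H K (beta : A (K ** H)) (alpha : A (H ** G)) L :
  pa_prod_r (pa_comp beta alpha) L
  = pa_comp (pa_prod_r beta L) (pa_prod_r alpha L).
Proof.
apply: (act_rel_fun
  (act_rel_compr (pa_comp_rel beta alpha) (pa_prod_r_rel _ L) _)
  (act_rel_pa_comp (pa_prod_r_rel beta L) (pa_prod_r_rel alpha L) _)).
- by move=> [k g]; exists ((k, 1%g), (g, 1%g)).
- by move=> [h l]; exists (1%g, l), (1%g, h).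
move=> [[k l] [g l']] [[k1 h1] [h2 g1]] /=; split.
  by case=> [[k2 g2] /= [[-> -> ->] [-> -> ->]]]; exists (h2, l').
by case=> [[h3 l3] /= [[-> <- ->] [<- -> ->]]]; exists (k1, g1).
Qed.

Lemma pa_prod_l_comp G H K (beta : A (K ** H)) (alpha : A (H ** G)) L :
  pa_prod_l L (pa_comp beta alpha)
  = pa_comp (pa_prod_l L beta) (pa_prod_l L alpha).
Proof.
apply: (act_rel_fun
  (act_rel_compr (pa_comp_rel beta alpha) (pa_prod_l_rel L _) _)
  (act_rel_pa_comp (pa_prod_l_rel L beta) (pa_prod_l_rel L alpha) _)).
- by move=> [k g]; exists ((1%g, k), (1%g, g)).
- by move=> [l h]; exists (l, 1%g), (1%g, h).
move=> [[l k] [l' g]] [[k1 h1] [h2 g1]] /=; split.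
  by case=> [[k2 g2] /= [[-> -> ->] [-> -> ->]]]; exists (l', h2).
by case=> [[l3 h3] /= [[-> <- ->] [<- -> ->]]]; exists (k1, g1).
Qed.

(** * Graphs of homomorphisms as morphisms of [P_A] *)

(* phi is the image of f : G -> H in P_A. *)
Definition graph G H (f : G -> H) (phi : A (H ** G)) : Prop :=
  act_rel (G := obj1 D) (H := H ** G) (fun p _ => p.1 = f p.2) (gf_one A) phi.

Lemma graph_eq G H (f g : G -> H) (phi psi : A (H ** G)) :
  graph f phi -> graph g psi -> f =1 g -> phi = psi.
Proof. by move=> Gf Gg E; apply: act_rel_fun Gf Gg _ => p _; rewrite E. Qed.

Lemma graph_id G : graph id (pa_id A G).
Proof.
apply: act_rel_ext (@indinf_rel (obj1 D) (G ** G) (objDelta G)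
  (@gdiag G) (@gtriv (objDelta G)) (gf_one A) _); last by exists (fun=> 1%g) => -[].
move=> [x y] [] /=; split=> [[[[z1 z2] zz] [E _]]|->].
  by move: (zz); rewrite inE => /eqP /= z12; case: E => -> ->.
have yy : (y, y) \in diag_group G by rewrite inE.
by exists (Subg yy).
Qed.

(** A graph is made from the identity element, and the product of the latter with [alpha] comes from
    [alpha] by the unit law. Composing with a graph thus only applies [f] to a coordinate. *)
Lemma graph_compl G H K (f : G -> H) (phi : A (H ** G)) (alpha : A (G ** K)) :
    graph f phi ->
  act_rel (G := G ** K) (H := H ** K) (fun p q => p.1 = f q.1 /\ p.2 = q.2)
    alpha (pa_comp phi alpha).
Proof.
move=> Gf.
apply: act_rel_ext (act_rel_compl (act_rel_unitl alpha)
  (act_rel_pa_comp Gf (act_rel_id alpha) _) _).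
- move=> [h k] [g k']; split=> /=.
    by case=> -[[] [g1 k1]] /= [[g2 [-> [-> ->]]] [-> ->]].
  by case=> -> ->; exists (tt, (g, k')); split=> //; exists g.
- by move=> g; exists (f g), tt.
- by move=> [[] p]; exists p.
Qed.

Lemma graph_compr G H K (f : K -> G) (phi : A (G ** K)) (beta : A (H ** G)) :
    graph f phi ->
  act_rel (G := H ** G) (H := H ** K) (fun p q => p.1 = q.1 /\ f p.2 = q.2)
    beta (pa_comp beta phi).
Proof.
move=> Gf.
apply: act_rel_ext (act_rel_compl (act_rel_unitr beta)
  (act_rel_pa_comp (act_rel_id beta) Gf _) _).
- move=> [h k] [h' g]; split=> /=.
    by case=> -[[h1 g1] []] /= [[g2 [[-> ->] ->]] [-> ->]].
  by case=> -> <-; exists ((h', f k), tt); split=> //; exists (f k).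
- by move=> g; exists 1%g, (1%g, g).
- by move=> [p []]; exists p.
Qed.

Lemma graph_comp G H K (f : G -> H) (g : K -> G) (phi : A (H ** G))
    (psi : A (G ** K)) :
  graph f phi -> graph g psi -> graph (f \o g) (pa_comp phi psi).
Proof.
move=> Gf Gg.
apply: act_rel_ext (act_rel_compr Gg (graph_compl psi Gf) _).
  move=> [h k] []; split=> /=.
    by case=> -[g1 k1] /= [[-> ->] ->].
  by move=> ->; exists (g k, k).
by move=> [x k]; exists (f x, k).
Qed.

Lemma graph_times G H K L (f : G -> H) (g : K -> L) (phi : A (H ** G))
    (psi : A (L ** K)) : graph f phi -> graph g psi ->
  @graph (G ** K) (H ** L) (fun p => (f p.1, g p.2))
    (pa_comp (pa_prod_r phi L) (pa_prod_l G psi)).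
Proof.
move=> Gf Gg.
apply: act_rel_ext (act_rel_compl (act_rel_unitl (gf_one A))
  (act_rel_pa_times Gf Gg) _).
  move=> [[h l] [x k]] []; split=> /=; first by case=> u [[-> ->]].
  by case=> -> ->; exists (tt, tt).
by move=> [[] []]; exists tt.
Qed.

Definition gpair G H (f : G -> H) (x : G) : (H * G)%type := (f x, x).

Fact gpairM G H (f : {multiplicative G -> H}) :
  {morph gpair f : x y / (x * y)%g}.
Proof. by move=> x y; rewrite /gpair gmulfM. Qed.
HB.instance Definition _ G H (f : {multiplicative G -> H}) :=
  isMultiplicative.Build _ _ (gpair f) (gpairM f).

(** For [f] the identity this is [pa_id G], with [G] in place of the isomorphic diagonal. *)
Definition graph_mor G H (f : {multiplicative G -> H}) : A (H ** G) :=
  bf_map A (G := obj1 D) (H := H ** G)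
    (rb_comp (rb R (Ind (gpair f))) (rb R (Inf (@gtriv G)))) (gf_one A).

Lemma graph_morP G H (f : {multiplicative G -> H}) : graph f (graph_mor f).
Proof.
apply: act_rel_ext (@indinf_rel (obj1 D) (H ** G) G (gpair f) (@gtriv G) _ _);
  last by exists (fun=> 1%g) => -[].
by move=> [h g] []; split=> /= [[k [[-> ->] _]]|->] //; exists g.
Qed.

(** The inverse map is again a homomorphism, and graphs compose as functions. *)
Lemma graph_mor_iso G H (f : {multiplicative G -> H}) :
  bijective f -> is_iso (C := PA A) (graph_mor f).
Proof.
case=> g fK gK.
have gM : {morph g : x y / (x * y)%g}.
  by move=> x y; rewrite -{1}[x]gK -{1}[y]gK -gmulfM fK.
pose g' : {multiplicative H -> G} :=
  HB.pack g (isMultiplicative.Build _ _ g gM).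
exists (graph_mor g').
have GG := graph_morP g'; have GF := graph_morP f.
split; first exact: graph_eq (graph_comp GG GF) (graph_id _) fK.
exact: graph_eq (graph_comp GF GG) (graph_id _) gK.
Qed.

(** * The category axioms, and functoriality against commutativity *)

Lemma PA_category : is_category (PA A).
Proof.
split=> [G H alpha|G H alpha|G H K L gamma beta alpha]; last exact: pa_compA.
  apply: act_rel_fun (graph_compl _ (graph_id H)) (act_rel_id alpha) _.
  by move=> [h g] [h' g'] /=; split=> [[-> ->]|[-> ->]].
apply: act_rel_fun (graph_compr _ (graph_id G)) (act_rel_id alpha) _.
by move=> [h g] [h' g'] /=; split=> [[-> ->]|[-> ->]].
Qed.

Lemma pa_times_id G K : fmor (pa_times A) (idm (p := prod_cat (PA A) (PA A)) (G, K))
  = pa_id A (G ** K).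
Proof.
apply: graph_eq (graph_times (graph_id G) (graph_id K)) (graph_id _) _.
by case.
Qed.

Lemma pa_prod_r_id G L : pa_prod_r (pa_id A G) L = pa_id A (G ** L).
Proof.
apply: graph_eq (_ : graph id _) (graph_id _) _ => //.
apply: act_rel_ext (act_rel_compr (graph_id G) (pa_prod_r_rel _ L) _).
  move=> [[g l] [g' l']] []; split=> /=.
    by case=> -[g1 g2] /= [[-> -> ->] ->].
  by case=> -> ->; exists (g', g').
by move=> [g g']; exists ((g, 1%g), (g', 1%g)).
Qed.

Lemma pa_prod_l_id G L : pa_prod_l L (pa_id A G) = pa_id A (L ** G).
Proof.
apply: graph_eq (_ : graph id _) (graph_id _) _ => //.
apply: act_rel_ext (act_rel_compr (graph_id G) (pa_prod_l_rel L _) _).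
  move=> [[l g] [l' g']] []; split=> /=.
    by case=> -[g1 g2] /= [[-> -> ->] ->].
  by case=> -> ->; exists (g', g').
by move=> [g g']; exists ((1%g, g), (1%g, g')).
Qed.

(** The two sides are [beta x alpha] and [alpha x beta] with permuted coordinates; commutativity
    supplies the swap between them. *)
Lemma pa_times_interchange : green_commutative A ->
  forall G H K L (alpha : A (H ** G)) (beta : A (L ** K)),
  pa_comp (pa_prod_l H beta) (pa_prod_r alpha K)
  = pa_comp (pa_prod_r alpha L) (pa_prod_l G beta).
Proof.
move=> /green_commutativeP comm G H K L alpha beta.
apply: (act_rel_fun
  (act_rel_compl (comm _ _ beta alpha)
    (act_rel_pa_times_rev (act_rel_id alpha) (act_rel_id beta)) _)
  (act_rel_pa_times (act_rel_id alpha) (act_rel_id beta))).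
  by move=> [p q]; exists (q, p).
move=> [[h l] [g k]] [p q]; split=> /=.
  by case=> -[q' p'] /= [[-> ->] [/= -> ->]].
by case=> <- <-; exists ((l, k), (h, g)).
Qed.

Lemma pa_times_functor : green_commutative A -> is_functor (pa_times A).
Proof.
move=> comm; split=> [[G K]|]; first exact: pa_times_id.
move=> [G K] [G' K'] [G'' K''] [beta beta'] [alpha alpha'] /=.
(* Once the composites are split, the two sides differ only in the order of the two middle
   factors. *)
rewrite pa_prod_r_comp pa_prod_l_comp -!pa_compA; congr pa_comp.
by rewrite !pa_compA; congr (pa_comp _ _); rewrite pa_times_interchange.
Qed.

Lemma pa_times_functor_comm : is_functor (pa_times A) -> green_commutative A.
Proof.
case: PA_category => idl idr _ [_ compF]; apply/green_commutativeP => H L a b.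
(* Multiplying by the identity element turns [a] and [b] into morphisms from the trivial group to
   [H] and [L]. *)
pose alpha := gf_prod A a (gf_one A); pose beta := gf_prod A b (gf_one A).
(* The composite of these pairs is [(alpha, beta)]; preserving it is the interchange law for [alpha]
   and [beta]. *)
have := compF (obj1 D, obj1 D) (H, obj1 D) (H, L)
  (pa_id A H, beta) (alpha, pa_id A (obj1 D)).
rewrite /= pa_prod_r_id pa_prod_l_id.
have -> : pa_comp (pa_id A H) alpha = alpha by exact: idl.
have -> : pa_comp beta (pa_id A (obj1 D)) = beta by exact: idr.
have -> : pa_comp (pa_id A (H ** L)) (pa_prod_l H beta) = pa_prod_l H beta.
  exact: idl.
have -> : pa_comp (pa_prod_r alpha (obj1 D)) (pa_id A (obj1 D ** obj1 D))
    = pa_prod_r alpha (obj1 D) by exact: idr.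
move=> E.
have Ra := act_rel_unitr a; have Rb := act_rel_unitr b.
have T := act_rel_pa_times Ra Rb; have T' := act_rel_pa_times_rev Ra Rb.
rewrite /= -/alpha -/beta E in T; rewrite -/alpha -/beta in T'.
(* By [E], the same [M] is reached from [a x b] through [T] and from [b x a] through [T']. *)
set M := pa_comp _ _ in T T'.
have P := @act_rel_push ((H ** L) ** (obj1 D ** obj1 D)) (H ** L)
  (@gfst (H ** L) (obj1 D ** obj1 D)) M.
have tot (x : (H ** L) ** (obj1 D ** obj1 D)) :
    exists g : H ** L, x.1.1 = g.1 /\ x.1.2 = g.2 by exists x.1.
(* Projecting away the trivial coordinates turns [M] into [a x b] along [T], and into the swap of
   [b x a] along [T']. *)
have <- : bf_map A (G := (H ** L) ** (obj1 D ** obj1 D)) (H := H ** L)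
    (rb R (Iso (@gfst (H ** L) (obj1 D ** obj1 D)))) M = gf_prod A a b.
  apply: act_rel_fun (act_rel_compl T P _) (act_rel_id _) _ => //.
  move=> [h l] [h' l'] /=; split.
    by case=> -[[h1 l1] u] /= [[-> ->] [-> ->]].
  by case=> -> ->; exists ((h', l'), (tt, tt)).
apply: act_rel_ext (act_rel_compl T' P _).
  move=> [h l] [h' l'] /=; split.
    by case=> -[[h1 l1] u] /= [[-> ->] [-> ->]].
  by case=> /= -> ->; exists ((l', h'), (tt, tt)).
by move=> [[h l] u]; exists (l, h).
Qed.

(** * The symmetric monoidal structure *)

Definition pa_assoc G H K : A ((G ** (H ** K)) ** (G ** H ** K)) :=
  @graph_mor (G ** H ** K) (G ** (H ** K)) (@gassoc G H K).
Definition pa_left G : A (G ** (obj1 D ** G)) :=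
  @graph_mor (obj1 D ** G) G (@gsnd unit G).
Definition pa_right G : A (G ** (G ** obj1 D)) :=
  @graph_mor (G ** obj1 D) G (@gfst G unit).
Definition pa_braid G H : A ((H ** G) ** (G ** H)) :=
  @graph_mor (G ** H) (H ** G) (@gswap G H).

Let assocP G H K : @graph (G ** H ** K) (G ** (H ** K)) (@gassoc G H K)
  (pa_assoc G H K). Proof. exact: graph_morP. Qed.
Let leftP G : @graph (obj1 D ** G) G (@gsnd unit G) (pa_left G).
Proof. exact: graph_morP. Qed.
Let rightP G : @graph (G ** obj1 D) G (@gfst G unit) (pa_right G).
Proof. exact: graph_morP. Qed.
Let braidP G H : @graph (G ** H) (H ** G) (@gswap G H) (pa_braid G H).
Proof. exact: graph_morP. Qed.

(** Convertible to [tenm] for [pa_times A], so that the naturality lemmas fit the fields of the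
    record. *)
Definition pa_tenm G H K L (f : A (H ** G)) (g : A (L ** K)) :
    A ((H ** L) ** (G ** K)) :=
  pa_comp (pa_prod_r f L) (pa_prod_l G g).

(** The two tensor products start from [(f x g) x h] and [f x (g x h)], which associativity of the
    Green product relates; the graphs only rebracket coordinates. *)
Lemma pa_assoc_nat G H K G' H' K' (f : A (G' ** G)) (g : A (H' ** H))
    (h : A (K' ** K)) :
  pa_comp (pa_assoc G' H' K') (pa_tenm (pa_tenm f g) h)
  = pa_comp (pa_tenm f (pa_tenm g h)) (pa_assoc G H K).
Proof.
apply: (act_rel_fun
  (act_rel_compr
    (act_rel_pa_times (act_rel_pa_times (act_rel_id f) (act_rel_id g))
      (act_rel_id h)) (graph_compl _ (assocP G' H' K')) _)
  (act_rel_compl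
    (act_rel_compl (act_rel_assoc _ _ _)
      (act_rel_pa_times (act_rel_id f)
        (act_rel_pa_times (act_rel_id g) (act_rel_id h))) _)
    (graph_compr _ (assocP G H K)) _)).
- by move=> [[[a b] c] [[x y] z]]; exists ((a, (b, c)), ((x, y), z)).
- by move=> [p [q r]]; exists (p, q, r).
- move=> [[a [b c]] [x [y z]]]; exists (((a, x), (b, y)), (c, z)).
  by exists ((a, x), ((b, y), (c, z))).
move=> [[a [b c]] [[x y] z]] [[[a1 x1] [b1 y1]] [c1 z1]]; split=> /=.
  case=> -[[[a2 b2] c2] [[x2 y2] z2]] /= [[[-> -> ->] [-> -> ->]]].
  move=> [[[<- <-] [<- <-]] [<- <-]].
  exists ((a2, (b2, c2)), (x2, (y2, z2))); split=> //.
  by exists ((a2, x2), ((b2, y2), (c2, z2))).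
case=> -[[a2 [b2 c2]] [x2 [y2 z2]]] /= [[[-> -> ->] [-> -> ->]]].
move=> [h2 [E h2E]]; rewrite h2E /= in E.
case: E => [[<- <-] [[<- <-] [<- <-]]].
by exists (((a2, b2), c2), ((x2, y2), z2)).
Qed.

(** The identity of the trivial group is a graph, hence comes from the identity element; by the unit
    law both sides then come from [f] alone. *)
Lemma pa_left_nat G G' (f : A (G' ** G)) :
  pa_comp (pa_left G') (pa_tenm (pa_id A (obj1 D)) f)
  = pa_comp f (pa_left G).
Proof.
apply: (act_rel_fun
  (act_rel_compl (act_rel_unitl f)
    (act_rel_compr
      (act_rel_pa_times (graph_id (obj1 D)) (act_rel_id f))
      (graph_compl _ (leftP G')) _) _)
  (graph_compr f (leftP G))).
- by move=> [[u a] [v b]]; exists (a, (v, b)).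
- by move=> [u p]; exists p.
move=> [a [[] b]] [a1 b1]; split=> /=.
  by case=> p [[[[u a2] [v b2]] /= [[-> [_ ->]] [_ <-]]] [<- <-]].
case=> -> <-; exists (tt, (a1, b)); split=> //.
by exists ((tt, a1), (tt, b)).
Qed.

Lemma pa_right_nat G G' (f : A (G' ** G)) :
  pa_comp (pa_right G') (pa_tenm f (pa_id A (obj1 D)))
  = pa_comp f (pa_right G).
Proof.
apply: (act_rel_fun
  (act_rel_compl (act_rel_unitr f)
    (act_rel_compr
      (act_rel_pa_times (act_rel_id f) (graph_id (obj1 D)))
      (graph_compl _ (rightP G')) _) _)
  (graph_compr f (rightP G))).
- by move=> [[a u] [b v]]; exists (a, (b, v)).
- by move=> [p u]; exists p.
move=> [a [b []]] [a1 b1]; split=> /=.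
  by case=> p [[[[a2 u] [b2 v]] /= [[-> [-> _]] [<- _]]] [<- <-]].
case=> -> <-; exists ((a1, b), tt); split=> //.
by exists ((a1, tt), (b, tt)).
Qed.

(** The braidings only permute coordinates, while the tensor products start from [f x g] and
    [g x f], which commutativity relates. *)
Lemma pa_braid_nat : green_commutative A ->
  forall G H G' H' (f : A (G' ** G)) (g : A (H' ** H)),
  pa_comp (pa_braid G' H') (pa_tenm f g) = pa_comp (pa_tenm g f) (pa_braid G H).
Proof.
move=> /green_commutativeP comm G H G' H' f g.
apply: (act_rel_fun
  (act_rel_compr (act_rel_pa_times (act_rel_id f) (act_rel_id g))
    (graph_compl _ (braidP G' H')) _)
  (act_rel_compl
    (act_rel_compl (comm _ _ g f)
      (act_rel_pa_times (act_rel_id g) (act_rel_id f)) _)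
    (graph_compr _ (braidP G H)) _)).
- by move=> [[a b] x]; exists ((b, a), x).
- by move=> [p q]; exists (q, p).
- move=> [[a b] [x y]]; exists ((b, y), (a, x)).
  by exists ((a, x), (b, y)).
move=> [[b a] [x y]] [[a1 x1] [b1 y1]]; split=> /=.
  case=> -[[a2 b2] [x2 y2]] /= [[[-> ->] [-> ->]] [[<- <-] [<- <-]]].
  exists ((b2, a2), (y2, x2)); split=> //.
  by exists ((b2, y2), (a2, x2)).
case=> -[[b2 a2] [y2 x2]] /= [[[-> ->] [-> ->]]].
move=> [[p q] /= [[<- <-] [/= [<- <-] [<- <-]]]].
by exists ((a2, b2), (x2, y2)).
Qed.

Lemma PA_symmetric_monoidal :
  green_commutative A -> symmetric_monoidal (pa_times A).
Proof.
move=> comm.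
refine (@SymmetricMonoidal (PA A) (pa_times A) PA_category
  (pa_times_functor comm) (obj1 D) pa_assoc pa_left pa_right pa_braid
  _ _ _ pa_assoc_nat pa_left_nat pa_right_nat (pa_braid_nat comm) _ _ _ _ _).
- move=> G H K; apply: graph_mor_iso.
  by exists (fun p => (p.1, p.2.1, p.2.2)) => [[[a b] c]|[a [b c]]].
- move=> G; apply: graph_mor_iso.
  by exists (fun g => (tt, g)) => // -[[]].
- move=> G; apply: graph_mor_iso.
  by exists (fun g => (g, tt)) => // -[g []].
(* From here on every morphism in the diagrams is a graph, so each axiom becomes a pointwise
   equality of maps on tuples. *)
- move=> G H.
  apply: graph_eq (graph_comp (graph_times (graph_id G) (leftP H))
    (assocP G (obj1 D) H)) (graph_times (rightP G) (graph_id H)) _.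
  by move=> [[a b] c].
- move=> G H K L.
  apply: graph_eq
    (graph_comp (assocP G H (K ** L)) (assocP (G ** H) K L))
    (graph_comp (graph_times (graph_id G) (assocP H K L))
      (graph_comp (assocP G (H ** K) L)
        (graph_times (assocP G H K) (graph_id L)))) _.
  by move=> [[[a b] c] d].
- move=> G H K.
  apply: graph_eq
    (graph_comp (assocP H K G)
      (graph_comp (braidP G (H ** K)) (assocP G H K)))
    (graph_comp (graph_times (graph_id H) (braidP G K))
      (graph_comp (assocP H G K)
        (graph_times (braidP G H) (graph_id K)))) _.
  by move=> [[a b] c].
- move=> G H.
  apply: graph_eq (graph_comp (braidP H G) (braidP G H)) (graph_id _) _.
  by move=> [a b].
- move=> G.
  apply: graph_eq (graph_comp (leftP G) (braidP G (obj1 D))) (rightP G) _.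
  by move=> [a b].
Qed.

End GreenRelation.

Theorem corollary26 (R : comPzRingType) (D : group_class)
    (A : green_functor R D) :
  (is_functor (pa_times A) <-> green_commutative A) /\
  (green_commutative A -> inhabited (symmetric_monoidal (pa_times A))).
Proof.
split; last by move=> /PA_symmetric_monoidal; exists.
by split; [exact: pa_times_functor_comm | exact: pa_times_functor].
Qed.
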